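(* There exists a universal constant $c>0$ such that for all integers $v\ge1$, $1\le t\le v$ and $t\le k\le v$ there exists, for some $\lambda$, a (simple) nonempty $t$-$(v,k,\lambda)$ design whose size is at most $\left(\frac{cv}{t}\right)^{ct}$.
   Context: A (simple) $t$-$(v,k,\lambda)$ design is a family $T$ of distinct subsets of $\{1,\ldots,v\}$, each of size $k$, such that for any distinct elements $i_1,\ldots,i_t\in\{1,\ldots,v\}$ one has $|\{s\in T:\ i_1,\ldots,i_t\in s\}|=\lambda$. Its size is the number $|T|$ of sets in the family. A universal constant is one independent of all other parameters. *)

(* Defs.v *)
From mathcomp Require Import all_boot.

Set Implicit Arguments.
Unset Strict Implicit.
Unset Printing Implicit Defensive.

(* The ground set {1, ..., v} is represented by 'I_v = {0, ..., v-1}.  The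
   blocks of T : {set {set 'I_v}} are distinct, so T is a simple design. *)
Definition is_design (t v k lambda : nat) (T : {set {set 'I_v}}) : Prop :=
  (forall s : {set 'I_v}, s \in T -> #|s| = k) /\
  (forall i : 'I_t -> 'I_v, injective i ->
     #|[set s in T | [forall j : 'I_t, i j \in s]]| = lambda).

(* Main.v *)
Require Import Defs.
From HB Require Import structures.
From mathcomp Require Import all_boot all_order all_algebra.
From mathcomp Require Import all_fingroup all_field.
From mathcomp Require Import reals sequences exp.
From mathcomp Require Import zify ring lra.

(** Write deg T b for the number of blocks of T that contain b, and put
    q = C(v + t, t), which is at most (2 e v / t) ^ t.  The aim is a nonempty
    family of k-sets, polynomial in q, whose degree is the same at all t-sets.
    If C(v, k) is itself polynomial in q, all k-sets together will do.
    Otherwise k and v - k are both much larger than t, and complementing the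
    blocks of a design gives a design, so v >= 2 k may be assumed.  In this
    range the family is built by exact local correction of a nearly balanced
    one.

    The corrections come from a gadget [gadget_exists]: two families P and Q of
    k-sets such that replacing P by Q lowers the degree of a single t-set a by
    a number mu and leaves the degree of every other t-set unchanged.  Take a
    set of k + t points around a and look at the blocks obtained by leaving out
    a hole of t points.  There are signed weights, depending on the number j of
    points of a in the hole, for which the weighted sum of the degrees vanishes
    at every t-set other than a [hole_sum]; this is the vanishing of a high
    difference of a polynomial of low degree.  The weights have the
    denominators C(t, j), and clearing them with a common multiple bounded by
    16 ^ t [bin_common_multiple] keeps mu polynomial in q.  The blocks must
    also be distinct although the weights are not 1: some points of the block
    are given a twin, and the copies of a block differ by exchanging points
    with their twins along the words of cosets of a binary linear code.  When
    every t columns of the code are independent, all cosets give the same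
    degrees on t-sets; when any two words used differ in more than t places, all
    blocks obtained are distinct [trade_families].  Random codes have both
    properties.

    Now plant r images p(P) of P under permutations p for each t-set p(a)
    [design_from_gadget].
    - The permutations are chosen one at a time: each image avoids the blocks
      used before, and its deviation from its mean is not positively correlated
      with the deviation accumulated so far (up to 1).  So squared deviations
      add up, and the final deviation has the order of the square root of the
      number of images, much less than r when r is a large power of q
      [greedy_choice].  The sum of the means is the same at all t-sets, because
      the symmetric group is transitive on them.
    - Among sufficiently many vectors modulo mu some nonempty subfamily sums to
      zero, so discarding a few images makes all degrees divisible by mu
      [trim_zero_sum].
    - All degrees now exceed the smallest one by a multiple of mu, at most mu
      times the number of images still available at each t-set.  Replacing
      the right number of images of P by the images of Q makes all degrees
      equal to the smallest one. *)

Set Implicit Arguments.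
Unset Strict Implicit.
Unset Printing Implicit Defensive.

Import Order.TTheory GRing.Theory Num.Theory.
Local Open Scope nat_scope.

(** * A common multiple of binomial coefficients, and signed weights *)

Lemma logn_fact_widen p n N : prime p -> n <= N -> logn p n`! = \sum_(1 <= i < N.+1) n %/ p ^ i.
Proof.
move=> pp nN; rewrite logn_fact // [RHS](big_cat_nat (n := n.+1)) //=.
rewrite [X in _ = _ + X]big_nat_cond [X in _ = _ + X]big1 ?addn0 // => i /andP[/andP[ni _] _].
by rewrite divn_small // (leq_trans ni) // ltnW // ltn_expl // prime_gt1.
Qed.

Lemma logn_bin_sum p n j : prime p -> j <= n ->
  \sum_(1 <= i < n.+1) n %/ p ^ i =
  logn p 'C(n, j) + \sum_(1 <= i < n.+1) (j %/ p ^ i + (n - j) %/ p ^ i).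
Proof.
move=> pp jn; rewrite -logn_fact // -(bin_fact jn) !lognM ?muln_gt0 ?fact_gt0 ?bin_gt0 ?jn //.
by rewrite big_split /= -!logn_fact_widen // leq_subr.
Qed.

(** Each term n / p^i - j / p^i - (n - j) / p^i of Legendre's formula is at
    most 1, and it is 0 once p^i > n. *)
Lemma logn_bin_le p n j : prime p -> j <= n -> logn p 'C(n, j) <= trunc_log p n.
Proof.
move=> pp jn; have p1 := prime_gt1 pp.
have := logn_bin_sum pp jn; set S := \sum_(1 <= i < n.+1) (_ + _) => E.
rewrite -(leq_add2r S) -E.
case: (posnP n) jn => [->|n0] jn; first by rewrite big_geq.
have tn : trunc_log p n < n.+1.
  by rewrite ltnS ltnW // (leq_trans (ltn_expl _ p1)) // trunc_logP.
have -> : trunc_log p n = \sum_(1 <= i < n.+1) (i <= trunc_log p n).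
  rewrite (big_cat_nat (n := (trunc_log p n).+1)) //= [X in _ + X]big_nat_cond.
  rewrite [X in _ + X]big1 ?addn0 => [|i /andP[/andP[ti _] _]]; last by rewrite leqNgt ti.
  rewrite big_nat_cond (eq_bigr (fun=> 1)) => [|i /andP[/andP[_ ti] _]]; last by rewrite -ltnS ti.
  by rewrite -big_nat_cond sum_nat_const_nat muln1 subn1.
rewrite -big_split /=; apply: leq_sum => i _.
have pi0 : 0 < p ^ i by rewrite expn_gt0 ltnW.
have [it|ti] := leqP i (trunc_log p n).
  rewrite -{1}(subnKC jn) divnD // addnC leq_add2r; exact: leq_b1.
have -> // : n %/ p ^ i = 0.
by rewrite divn_small // (leq_trans (trunc_log_ltn n p1)) // leq_exp2l.
Qed.

(** At most one power of p lies between m (excluded) and 2m, and such a power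
    contributes 1 to Legendre's formula for C(2m, m). *)
Lemma trunc_log_double p m : prime p -> 0 < m ->
  trunc_log p (2 * m) <= trunc_log p m + logn p 'C(2 * m, m).
Proof.
move=> pp m0; have p1 := prime_gt1 pp; set e := trunc_log p (2 * m).
have m20 : 0 < 2 * m by rewrite muln_gt0.
have pe2 : p ^ e <= 2 * m by apply: trunc_logP.
have [|lt] := leqP (p ^ e) m.
  by move/(trunc_log_max p1); lia.
have e0 : 0 < e by rewrite lt0n; apply: contraTneq lt => ->; rewrite expn0 -leqNgt.
have e1 : e.-1 <= trunc_log p m.
  apply: trunc_log_max => //; rewrite -(leq_pmul2l (isT : 0 < 2)).
  apply: leq_trans pe2; rewrite -{2}(prednK e0) expnS leq_mul2r p1 orbT //.
suff : 0 < logn p 'C(2 * m, m) by lia.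
have mm : m <= 2 * m by lia.
have E := logn_bin_sum pp mm.
rewrite -(ltn_add2r (\sum_(1 <= i < (2 * m).+1) (m %/ p ^ i + (2 * m - m) %/ p ^ i))) -E add0n.
have em : e < (2 * m).+1 by rewrite ltnS ltnW // (leq_trans (ltn_expl _ p1)).
have mE : 2 * m - m = m by lia.
rewrite mE (bigD1_seq e) ?mem_index_iota ?iota_uniq ?e0 //=
  [X in _ < X](bigD1_seq e) ?mem_index_iota ?iota_uniq ?e0 //=.
rewrite divn_small // addn0 -[X in X < _]add0n -addSn; apply: leq_add.
  by rewrite divn_gt0 // expn_gt0 ltnW.
apply: leq_sum => i _; have := divnD m m (_ : 0 < p ^ i); rewrite addnn -mul2n => -> //.
  exact: leq_addr.
by rewrite expn_gt0 ltnW.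
Qed.

Lemma bin_le_pow2 n j : 'C(n, j) <= 2 ^ n.
Proof.
rewrite -[2]/(1 + 1) expnDn; have [jn|/bin_small -> //] := leqP j n.
by rewrite (bigD1 (Ordinal (jn : j < n.+1))) //= !exp1n !muln1 leq_addr.
Qed.

(** Multiplying by C(2m, m), with m half of t rounded up, and then repeating
    with m, catches every prime power up to t.  A bound of the form c^t, instead
    of t!, is what the modulus of the gadget requires. *)
Lemma bin_common_multiple t : exists L,
  [/\ 0 < L, L <= 16 ^ t & forall j, j <= t -> 'C(t, j) %| L].
Proof.
suff [L [L0 L16 LP]] : exists L, [/\ 0 < L, L <= 16 ^ t &
    forall p, prime p -> trunc_log p t <= logn p L].
  exists L; split=> // j jt; apply/dvdn_partP => [|p]; first by rewrite bin_gt0.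
  rewrite mem_primes => /andP[pp _]; rewrite p_part pfactor_dvdn //.
  exact: leq_trans (logn_bin_le pp jt) (LP p pp).
elim/ltn_ind: t => t IH; have [t1|t1] := leqP t 1.
  exists 1; rewrite expn_gt0; split=> // p pp.
  by case: t t1 {IH} => [|[|]] // _; rewrite ?trunc_log0 ?trunc_log1.
have [L [L0 L16 LP]] := IH (uphalf t) ltac:(lia).
set m := uphalf t in L16 LP; have m0 : 0 < m by rewrite /m; lia.
exists ('C(2 * m, m) * L); split.
- by rewrite muln_gt0 bin_gt0 L0 andbT; lia.
- apply: leq_trans (leq_mul (bin_le_pow2 _ _) L16) _.
  by rewrite -[16]/(2 ^ 4) -!expnM -expnD leq_exp2l // /m; lia.
- move=> p pp; rewrite lognM //; last by rewrite bin_gt0; lia.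
  apply: leq_trans (leq_trunc_log p (_ : t <= 2 * m)) _; first by rewrite /m; lia.
  apply: leq_trans (trunc_log_double pp m0) _.
  by rewrite addnC leq_add2l LP.
Qed.

Local Open Scope ring_scope.

(** The s-th difference of a polynomial of degree r < s is zero. *)
Lemma alternating_bin_sum (A s r : nat) : (r < s)%N ->
  \sum_(j < s.+1) (-1) ^+ j * ('C(s, j) * 'C(A + j, r))%:R = 0 :> int.
Proof.
elim: s A r => // s IH A r rs.
pose S (B q : nat) : int := \sum_(j < s.+1) (-1) ^+ j * ('C(s, j) * 'C(B + j, q))%:R.
have SE B q : S B q = \sum_(j < s.+2) (-1) ^+ j * ('C(s, j) * 'C(B + j, q))%:R.
  by rewrite [RHS]big_ord_recr /= bin_small // mul0n mulr0 addr0.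
rewrite (_ : \sum_(j < s.+2) _ = S A r - S A.+1 r); last first.
  rewrite SE /S big_ord_recl [in RHS]big_ord_recl /= !bin0 -addrA; congr (_ + _).
  rewrite -sumrB; apply: eq_bigr => j _; rewrite /bump /= add1n binS exprS.
  by rewrite mulnDl natrD addnS addSn; ring.
case: r rs => [|r] rs.
  by rewrite (_ : S A.+1 0%N = S A 0%N) ?subrr //; apply: eq_bigr => j _; rewrite !bin0.
rewrite (_ : S A.+1 r.+1 = S A r.+1 + S A r) ?opprD ?addrA ?subrr ?sub0r.
  by rewrite /S IH ?oppr0.
rewrite -big_split /=; apply: eq_bigr => j _.
by rewrite addSn binS mulnDr natrD mulrDr.
Qed.

Section Weights.
Variables (t K L : nat).
Hypotheses (L0 : (0 < L)%N) (LP : forall j, (j <= t)%N -> ('C(t, j) %| L)%N).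
Hypotheses (K0 : (0 < K)%N) (tK : (t <= K)%N).

(** The absolute value of the weight of a block whose hole contains j points
    of the distinguished t-set, with K + t the block size.  With the sign (-1)^j
    it is, up to a factor, the unique solution of the triangular system in
    [hole_weight_orthogonal]; L clears the denominators C(t, j). *)
Definition hole_weight (j : nat) : nat := (L %/ 'C(t, j) * 'C(K.-1 + j, j))%N.

Lemma hole_weight0 : hole_weight 0 = L.
Proof. by rewrite /hole_weight !bin0 divn1 muln1. Qed.

Lemma hole_weight_le j : (j <= t)%N -> (hole_weight j <= L * 'C(K + t, t))%N.
Proof.
move=> jt; apply: leq_mul; first exact: leq_div.
rewrite -bin_sub ?leq_addl // addnK; apply: (@leq_trans 'C(K.-1 + t, K.-1)).
  by apply: leq_bin2l; rewrite leq_add2l.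
rewrite -bin_sub ?leq_addr // addKn; apply: leq_bin2l.
by rewrite leq_add2r leq_pred.
Qed.

(** The point is that the right-hand side depends on j only through
    C(K - 1 + j, s - 1), a polynomial in j of degree less than s. *)
Lemma hole_weight_bin (s j : nat) : (j <= s)%N -> (0 < s <= t)%N ->
  (t`! * K.-1`! * (hole_weight j * 'C(K + t - s, t - j)) =
   L * (K + t - s)`! * s.-1`! * 'C(K.-1 + j, s.-1))%N.
Proof.
move=> js /andP[s0 st]; have jt := leq_trans js st.
have b0 : (0 < 'C(t, j))%N by rewrite bin_gt0.
(* everything is expressed by factorials; q stands for L / C(t, j) *)
have h1 : ('C(K.-1 + j, j) * (j`! * K.-1`!) = (K.-1 + j)`!)%N.
  by have := bin_fact (leq_addl K.-1 j); rewrite addnK.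
have h2 : ('C(K + t - s, t - j) * ((t - j)`! * (K + j - s)`!) = (K + t - s)`!)%N.
  rewrite (_ : K + j - s = K + t - s - (t - j))%N ?bin_fact //; lia.
have h3 := bin_fact jt.
have h4 : ('C(K.-1 + j, s.-1) * (s.-1`! * (K + j - s)`!) = (K.-1 + j)`!)%N.
  rewrite (_ : K + j - s = K.-1 + j - s.-1)%N ?bin_fact //; lia.
apply/eqP; rewrite -(eqn_pmul2l b0) /hole_weight; apply/eqP.
have := divnK (LP jt); set q := (L %/ _)%N => <-.
move: h1 h2 h3 h4; set b1 := 'C(_, j); set b2 := 'C(_, t - j); set b3 := 'C(t, j).
set b4 := 'C(_, s.-1); move=> h1 h2 h3 h4.
rewrite -h3 -h2.
transitivity (b3 * b3 * q * b2 * (t - j)`! * (b1 * (j`! * K.-1`!)))%N; first by ring.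
rewrite h1 -h4; ring.
Qed.

(** The product of the two binomial coefficients counts the holes with j
    points in the distinguished t-set a that avoid a given t-set b, when s points
    of a lie outside b.  So this says that b is seen with total weight 0 unless
    b = a. *)
Lemma hole_weight_orthogonal (s : nat) : (s <= t)%N ->
  \sum_(j < s.+1) (-1) ^+ j * (hole_weight j * ('C(s, j) * 'C(K + t - s, t - j)))%:R =
  ((s == 0%N) * (L * 'C(K + t, t)))%:R :> int.
Proof.
case: s => [|s] st.
  by rewrite big_ord1 hole_weight0 bin0 expr0 !mul1r subn0 !mul1n subn0.
rewrite mul0n; have c0 : (t`! * K.-1`!)%:R != 0 :> int.
  by rewrite pnatr_eq0 muln_eq0 !negb_or -!lt0n !fact_gt0.
apply: (mulfI c0); rewrite mulr0 mulr_sumr.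
rewrite (eq_bigr (fun j : 'I_s.+2 => (L * (K + t - s.+1)`! * s`!)%:R *
    ((-1) ^+ j * ('C(s.+1, j) * 'C(K.-1 + j, s))%:R))) => [|j _].
  by rewrite -mulr_sumr alternating_bin_sum ?mulr0.
rewrite mulrCA -natrM [in RHS]mulrCA -natrM; congr (_ * _%:R).
have := @hole_weight_bin s.+1 j (ltn_ord j) st; rewrite /= => E.
by rewrite (mulnCA (hole_weight j)) mulnCA E; ring.
Qed.
End Weights.

Local Open Scope nat_scope.

Lemma bin_mul_pow n t a : 'C(n, t) * a ^ (n - t) <= a.+1 ^ n.
Proof.
have [tn|/bin_small -> //] := leqP t n.
rewrite -addn1 expnDn (bigD1 (Ordinal (tn : t < n.+1))) //= exp1n muln1.
exact: leq_addr.
Qed.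

Lemma pow16_le : 16 ^ 6 <= 2 * 15 ^ 6.
Proof.
have gen a b : 7 * a <= 8 * b -> a ^ 3 <= 2 * b ^ 3.
  rewrite -(@leq_exp2r _ _ 3) // !expnMn; move: (a ^ 3) (b ^ 3) => x y; lia.
by rewrite (expnM 16 2 3) (expnM 15 2 3) gen.
Qed.

Lemma pow6_le_pow2 k t a b c : t <= k -> 0 < a -> b ^ 6 <= 2 * a ^ 6 ->
  c * a ^ (k - t) <= b ^ k -> c ^ 6 <= 2 ^ k * (a ^ t) ^ 6.
Proof.
move=> tk a0 ba cab; have p0 : 0 < (a ^ (k - t)) ^ 6 by rewrite !expn_gt0 a0.
rewrite -(leq_pmul2r p0) -expnMn -mulnA -expnMn -expnD subnKC //.
apply: (@leq_trans ((b ^ k) ^ 6)); first by rewrite leq_exp2r.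
rewrite -!expnM !(mulnC k) !(expnM _ 6) -expnMn.
by case: k {tk p0 cab} => // k; rewrite leq_exp2r.
Qed.

(** From C(k, t) 15^(k - t) <= 16^k, because (16/15)^6 < 2.  The exponent 6
    keeps C(k, t)^3, which the codes need, below 2^(k/2) up to a factor c^t. *)
Lemma bin6_le k t : t <= k -> 'C(k, t) ^ 6 <= 2 ^ (k + 24 * t).
Proof.
move=> tk; apply: leq_trans (pow6_le_pow2 tk (isT : 0 < 15) pow16_le (bin_mul_pow k t 15)) _.
rewrite expnD leq_mul2l; apply/orP; right.
apply: (@leq_trans ((16 ^ t) ^ 6)).
  by rewrite leq_exp2r //; case: (t) => // q; rewrite leq_exp2r.
by rewrite -[16]/(2 ^ 4) -!expnM; apply: eq_leq; congr (_ ^ _); lia.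
Qed.

Lemma code_length_suffices t k : 0 < t -> 42 * t <= k ->
  16 * 'C(k, t) ^ 2 * (16 ^ t * 'C(k, t)) <= 2 ^ (k - t).
Proof.
move=> t0 tk; rewrite -(@leq_exp2r _ _ 2) //.
have p2 : (16 ^ t) ^ 2 = 2 ^ (8 * t).
  by rewrite -[16]/(2 ^ 4) -!expnM; congr (_ ^ _); lia.
have -> : (16 * 'C(k, t) ^ 2 * (16 ^ t * 'C(k, t))) ^ 2 = 2 ^ (8 + 8 * t) * 'C(k, t) ^ 6.
  rewrite expnD -p2; move: 'C(k, t) (16 ^ t) => c p.
  by rewrite (_ : 2 ^ 8 = 16 * 16) //; ring.
apply: leq_trans (leq_mul (leqnn _) (bin6_le (_ : t <= k))) _; first by lia.
by rewrite -expnD -expnM leq_exp2l //; lia.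
Qed.

(** * Degrees of families of sets, and permutations of the points *)

Section Perms.
Variable V : finType.
Implicit Types (p : {perm V}) (A B b : {set V}) (T : {set {set V}}).

Definition deg T b := #|[set s in T | b \subset s]|.
Definition perm_family p T : {set {set V}} := [set p @: (s : {set V}) | s in T].

Lemma perm_onto A B : #|A| = #|B| -> exists p, p @: A = B.
Proof.
move=> AB; pose e (C : {set V}) := enum C ++ enum (~: C).
have eU C : uniq (e C).
  rewrite cat_uniq !enum_uniq andbT /=; apply/hasPn => x.
  by rewrite !mem_enum inE.
have eM C x : x \in e C by rewrite mem_cat !mem_enum inE orbN.
have eS C : size (e C) = #|V|.
  by rewrite size_cat -!cardE cardsC.
have fI : injective (fun x => nth x (e B) (index x (e A))).
  move=> x y /=; rewrite (set_nth_default y) ?eS -?(eS A) ?index_mem // => /eqP.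
  by rewrite nth_uniq ?eS -?(eS A) ?index_mem // => /eqP/(congr1 (nth x (e A))); rewrite !nth_index.
exists (perm fI); apply/eqP; rewrite eqEcard card_imset ?AB ?leqnn ?andbT; last exact: perm_inj.
apply/subsetP => _ /imsetP[x xA ->]; rewrite permE -mem_enum.
have xe : x \in enum A by rewrite mem_enum.
have lt : index x (enum A) < size (enum B) by rewrite -cardE -AB cardE index_mem.
by rewrite /e index_cat xe nth_cat lt mem_nth.
Qed.

Lemma imset_permM p q A : (p * q)%g @: A = q @: (p @: A).
Proof. by rewrite -imset_comp; apply: eq_imset => x; rewrite /= permM. Qed.

(** Both sides count all permutations, on the left according to the image of
    A, which is any set of size #|A| equally often. *)
Lemma card_perm_onto A B : #|A| = #|B| ->
  #|[set p : {perm V} | p @: A == B]| * 'C(#|V|, #|A|) = #|[set: {perm V}]|.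
Proof.
move=> AB; rewrite mulnC -cardsT -(cards_draws [set: V]) -[in RHS]sum1_card.
set D := [set C | _].
rewrite (partition_big (fun p : {perm V} => p @: A) (mem D)) /=; last first.
  by move=> p _; rewrite inE subsetT /= card_imset //; apply: perm_inj.
rewrite -sum_nat_const; apply: eq_bigr => C; rewrite inE => /andP[_ /eqP CA].
have [q qB] : exists q : {perm V}, q @: B = C by apply: perm_onto; rewrite CA.
rewrite sum1_card -[LHS](card_imset _ (mulIg q)); apply: eq_card => p.
rewrite [in RHS]unfold_in /= inE /=.
apply/imsetP/eqP => [[u]|H].
  by rewrite inE => /eqP uA ->; rewrite imset_permM uA.
exists (p * q^-1)%g; last by rewrite mulgKV.
rewrite inE imset_permM H -qB -imset_permM mulgV; apply/eqP.
by rewrite -[RHS]imset_id; apply: eq_imset => x; rewrite perm1.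
Qed.

Lemma card_perm_family p T : #|perm_family p T| = #|T|.
Proof. by rewrite card_imset //; apply: imset_inj; apply: perm_inj. Qed.

Lemma perm_familyM p q T : perm_family (p * q) T = perm_family q (perm_family p T).
Proof.
by rewrite /perm_family -[RHS]imset_comp; apply: eq_imset => x /=; apply: imset_permM.
Qed.

Lemma deg_perm p T b : deg (perm_family p T) (p @: b) = deg T b.
Proof.
have pI := imset_inj (@perm_inj _ p).
rewrite /deg -[RHS](card_imset _ pI); apply: eq_card => s; rewrite !inE.
apply/andP/imsetP => [[/imsetP[u uT ->] bu]|[u]].
  exists u => //; rewrite inE uT; apply/subsetP => x xb.
  by have /subsetP/(_ _ (imset_f p xb)) := bu; rewrite mem_imset //; apply: perm_inj.
by rewrite inE => /andP[uT bu] ->; split; [apply: imset_f|apply: imsetS].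
Qed.

Lemma degE T b : deg T b = \sum_(s in T) (b \subset s).
Proof.
rewrite /deg -sum1_card big_mkcond [RHS]big_mkcond /=.
by apply: eq_bigr => s _; rewrite inE; case: (s \in T).
Qed.

Lemma deg_bigcup (I : finType) (J : {set I}) (F : I -> {set {set V}}) b :
  (forall i j, i != j -> [disjoint F i & F j]) ->
  deg (\bigcup_(i in J) F i) b = \sum_(i in J) deg (F i) b.
Proof.
move=> dF; rewrite degE.
have -> : \bigcup_(i in J) F i = \bigcup_i (if i \in J then F i else set0).
  by rewrite big_mkcond.
rewrite partition_disjoint_bigcup => [|i j ij].
  rewrite [RHS]big_mkcond; apply: eq_bigr => i _.
  by case: ifP => _; rewrite ?degE // big_set0.
by do 2 case: ifP => _; rewrite ?dF // disjoints_subset ?sub0set // setC0 subsetT.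
Qed.
End Perms.

Lemma card_le_sum (T I : finType) (X : {set T}) (J : {set I}) (F : I -> {set T}) :
  (forall x, x \in X -> exists2 i, i \in J & x \in F i) ->
  #|X| <= \sum_(i in J) #|F i|.
Proof.
move=> H; under eq_bigr do rewrite -sum1_card big_mkcond /=.
rewrite exchange_big /= -sum1_card big_mkcond /=; apply: leq_sum => x _.
by case: ifP => // /H[i iJ xi]; rewrite (bigD1 i) //= xi.
Qed.

Lemma disjointPn (T : finType) (X Y : {set T}) :
  reflect (exists2 x, x \in X & x \in Y) (~~ [disjoint X & Y]).
Proof.
rewrite -setI_eq0; apply: (iffP idP) => [/set0Pn[x]|[x xX xY]].
  by rewrite inE => /andP[]; exists x.
by apply/set0Pn; exists x; rewrite inE xX.
Qed.

Lemma subset_of_card (T : finType) (X : {set T}) n : n <= #|X| ->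
  exists B : {set T}, (B \subset X) && (#|B| == n).
Proof.
rewrite -bin_gt0 -cards_draws card_gt0 => /set0Pn[B].
by rewrite inE; exists B.
Qed.

(** * Binary codes whose cosets agree on any t coordinates *)

(** Translation by g (z' - z) identifies the fibers over z and z'. *)
Lemma card_additive_fiber (G G' : finZmodType) (f : G -> G') (g : G' -> G) (z : G') :
  {morph f : x y / (x + y)%R} -> cancel g f ->
  #|[set x | f x == z]| * #|G'| = #|G|.
Proof.
move=> fD gK; rewrite mulnC -[RHS]sum1_card (partition_big f predT) //=.
rewrite -sum_nat_const; apply: eq_bigr => z' _; rewrite sum1_card.
rewrite -[LHS](card_imset _ (addIr (g (z' - z)%R))); apply: eq_card => x.
rewrite unfold_in; apply/imsetP/eqP => [[u]|fx].
  by rewrite inE => /eqP fu ->; rewrite fD gK fu addrC subrK.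
exists (x - g (z' - z))%R; last by rewrite subrK.
by rewrite inE -(inj_eq (addIr (z' - z)%R)) -{2}[(z' - z)%R]gK -fD subrK fx addrC subrK.
Qed.

(** Vandermonde's identity, each C(n, i) with i <= t being multiplied by
    C(t, t - i) >= 1. *)
Lemma card_small_sets n t : #|[set x : {set 'I_n} | #|x| <= t]| <= 'C(n + t, t).
Proof.
rewrite -sum1_card (partition_big (fun x : {set 'I_n} => inord #|x| : 'I_t.+1) predT) //=.
rewrite -binomial.Vandermonde; apply: leq_sum => i _.
apply: (@leq_trans 'C(n, i)); last by rewrite leq_pmulr // bin_gt0 leq_subr.
have <- : #|[set A : {set 'I_n} | A \subset [set: 'I_n] & #|A| == i]| = 'C(n, i).
  by rewrite cards_draws cardsT card_ord.
rewrite sum1_card; apply: subset_leq_card.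
apply/subsetP => x; rewrite unfold_in !inE subsetT => /andP[xt /eqP xi].
by rewrite -xi inordK ?eqxx.
Qed.

Section Words.
Variable n : nat.
Implicit Types (u : 'rV['F_2]_n).

Definition support_set u : {set 'I_n} := [set i | u 0%R i != 0%R].
Definition symdiff (x x' : {set 'I_n}) := (x :\: x') :|: (x' :\: x).

Lemma symdiff_support u u' : symdiff (support_set u) (support_set u') = support_set (u - u')%R.
Proof.
apply/setP => i; rewrite !inE !mxE.
by case: (u _ _) => [[|[|//]] //= ?]; case: (u' _ _) => [[|[|//]] //= ?].
Qed.

Lemma support_set_inj : injective support_set.
Proof.
move=> u u' E; apply/eqP; rewrite -subr_eq0; apply/eqP/rowP => i; rewrite [RHS]mxE.
have := symdiff_support u u'; rewrite E /symdiff setDv setU0 => /setP/(_ i).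
by rewrite !inE => /esym/negbFE/eqP.
Qed.
End Words.

(** Union bound over a uniformly random H.  A fixed combination of columns of
    the upper block vanishes with probability 2^-r, and y H is uniformly
    distributed for each nonzero y. *)
Lemma good_matrix (n t r q V : nat) :
  #|[set x : {set 'I_n} | #|x| <= t]| <= V -> 2 * V < 2 ^ r -> 2 * (2 ^ (r + q) * V) <= 2 ^ n ->
  exists H : 'M['F_2]_(r + q, n),
    (forall s : 'rV_n, s != 0%R -> #|support_set s| <= t -> (usubmx H *m s^T)%R != 0%R) /\
    (forall y : 'rV_(r + q), y != 0%R -> t < #|support_set (y *m H)%R|).
Proof.
move=> smallV Vr Vn; set M := 'M['F_2]_(r + q, n).
pose S := [set s : 'rV['F_2]_n | (s != 0%R) && (#|support_set s| <= t)].
pose Z := [set z : 'rV['F_2]_n | #|support_set z| <= t].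
have Zle : #|Z| <= V.
  apply: leq_trans smallV; rewrite -(card_imset _ (@support_set_inj n)); apply: subset_leq_card.
  by apply/subsetP => x /imsetP[z]; rewrite !inE => zt ->.
have Sle : #|S| <= V.
  by apply: leq_trans Zle; apply: subset_leq_card; apply/subsetP => s; rewrite !inE => /andP[].
pose B1 (s : 'rV['F_2]_n) := [set H : M | (usubmx H *m s^T)%R == 0%R].
pose B2 (yz : 'rV['F_2]_(r + q) * 'rV['F_2]_n) := [set H : M | (yz.1 *m H)%R == yz.2].
have cF : #|'F_2| = 2 by rewrite card_Fp.
have B1c s : s \in S -> #|B1 s| * 2 ^ r = #|{: M}|.
  rewrite inE => /andP[s0 _]; have [j sj] := rV0Pn _ s0.
  have <- : #|{: 'cV['F_2]_r}| = 2 ^ r by rewrite card_mx cF muln1.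
  apply: (@card_additive_fiber _ _ (fun H : M => usubmx H *m s^T)%R
     (fun z => col_mx (z *m ((s 0 j)^-1 *: delta_mx 0 j)) 0)%R 0%R) => [H H'|z].
    rewrite (_ : usubmx (H + H') = usubmx H + usubmx H')%R ?mulmxDl //.
    by apply/matrixP => a b; rewrite !mxE.
  rewrite col_mxKu -mulmxA -scalemxAl -rowE; apply/colP => i.
  rewrite mxE big_ord1 !mxE mulVf ?mulr1 //.
have B2c yz : yz.1 != 0%R -> #|B2 yz| * 2 ^ n = #|{: M}|.
  case: yz => y z /= y0; have [j yj] := rV0Pn _ y0.
  have <- : #|{: 'rV['F_2]_n}| = 2 ^ n by rewrite card_mx cF mul1n.
  apply: (@card_additive_fiber _ _ (fun H : M => y *m H)%R
     (fun z => ((y 0 j)^-1 *: delta_mx j 0) *m z)%R z) => [H H'|z'].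
    by rewrite mulmxDr.
  rewrite mulmxA -scalemxAr -colE; apply/rowP => i.
  by rewrite mxE big_ord1 !mxE mulVf ?mul1r.
pose Y := [set yz : 'rV['F_2]_(r + q) * 'rV['F_2]_n | (yz.1 != 0%R) && (yz.2 \in Z)].
pose bad := (\bigcup_(s in S) B1 s) :|: (\bigcup_(yz in Y) B2 yz).
have M0 : 0 < #|{: M}| by rewrite card_mx cF expn_gt0.
have b1 : 2 * #|\bigcup_(s in S) B1 s| < #|{: M}|.
  have le : #|\bigcup_(s in S) B1 s| <= \sum_(s in S) #|B1 s|.
    by apply: card_le_sum => H /bigcupP[s]; exists s.
  rewrite -(ltn_pmul2r (_ : 0 < 2 ^ r)) ?expn_gt0 //.
  apply: (@leq_ltn_trans (2 * (V * #|{: M}|))); last by rewrite mulnA mulnC ltn_pmul2l.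
  rewrite -mulnA leq_mul2l /=.
  apply: leq_trans (leq_mul le (leqnn _)) _; rewrite big_distrl /= (eq_bigr _ B1c).
  by rewrite sum_nat_const leq_mul2r Sle orbT.
have b2 : 2 * #|\bigcup_(yz in Y) B2 yz| <= #|{: M}|.
  have le : #|\bigcup_(yz in Y) B2 yz| <= \sum_(yz in Y) #|B2 yz|.
    by apply: card_le_sum => H /bigcupP[s]; exists s.
  rewrite -(leq_pmul2r (_ : 0 < 2 ^ n)) ?expn_gt0 //.
  apply: (@leq_trans (2 * (2 ^ (r + q) * V * #|{: M}|))); last by rewrite mulnA mulnC leq_pmul2l.
  rewrite -mulnA leq_mul2l /=.
  apply: leq_trans (leq_mul le (leqnn _)) _; rewrite big_distrl /=.
  rewrite (eq_bigr (fun=> #|{: M}|)) => [|yz]; last by rewrite inE => /andP[y0 _]; apply: B2c.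
  rewrite sum_nat_const leq_mul2r; apply/orP; right.
  apply: (@leq_trans #|setX [set: 'rV['F_2]_(r + q)] Z|).
    by apply: subset_leq_card; apply/subsetP => yz; rewrite !inE => /andP[].
  by rewrite cardsX cardsT card_mx cF mul1n leq_mul2l Zle orbT.
have : bad != [set: M].
  apply: contraTneq b1 => E; rewrite -leqNgt -(leq_add2r #|{: M}|) addnn -mul2n.
  rewrite -{1}cardsT -E; apply: (@leq_trans (2 * (#|\bigcup_(s in S) B1 s| + #|\bigcup_(yz in Y) B2 yz|))).
    by rewrite leq_mul2l leq_card_setU.
  by rewrite mulnDr leq_add2l.
rewrite eqEsubset subsetT /= => /subsetPn[H _]; rewrite inE negb_or => /andP[H1 H2].
exists H; split=> [s s0 st|y y0].
  by apply: contra H1 => Hs; apply/bigcupP; exists s; rewrite inE // s0.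
rewrite ltnNge; apply: contra H2 => Hy; apply/bigcupP; exists (y, (y *m H)%R).
  by rewrite !inE y0.
by rewrite inE.
Qed.

(** The words of family c are y Hu + e(c) Hd, where Hu and Hd are the upper
    and lower blocks of the matrix H of [good_matrix]: each family is a coset of
    the row space of Hu.  Every t columns of Hu being independent, restriction
    of this row space to t coordinates is onto, so all cosets have the same
    distribution on J.  Differences of words are nonzero words y H, hence of
    weight more than t. *)
Lemma trade_families (n t f : nat) : 0 < f -> 16 * 'C(n + t, t) ^ 2 * f <= 2 ^ n ->
  exists (r : nat) (w : 'I_f -> 'rV['F_2]_r -> {set 'I_n}),
  [/\ 2 ^ r <= 4 * 'C(n + t, t),
      forall (J : {set 'I_n}) (h : {set 'I_n} -> int) c c', #|J| <= t ->
        (forall x x', x :&: J = x' :&: J -> h x = h x') ->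
        (\sum_y h (w c y) = \sum_y h (w c' y))%R
    & forall c y c' y', #|symdiff (w c y) (w c' y')| <= t -> (c, y) = (c', y')].
Proof.
move=> f0; set V := 'C(n + t, t) => room.
have V0 : 0 < V by rewrite bin_gt0 leq_addl.
(* 2^r > 2 V is needed for the columns; 2^q >= f cosets are needed. *)
pose r := (trunc_log 2 V).+2; pose q := up_log 2 f.
have rlow : 2 * V < 2 ^ r by rewrite expnS ltn_pmul2l // trunc_log_ltn.
have rup : 2 ^ r <= 4 * V by rewrite !expnS mulnA leq_pmul2l // trunc_logP.
have qlow : f <= 2 ^ q by apply: up_logP.
have qup : 2 ^ q <= 2 * f.
  have [f1|f1] := leqP f 1.
    rewrite /q (_ : up_log 2 f = 0) ?muln_gt0 //; apply/eqP; by rewrite up_log_eq0 // f1 orbT.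
  have /andP[] := up_log_bounds (isT : 1 < 2) f1; rewrite -/q => lo _.
  have q0 : 0 < q by rewrite up_log_gt0.
  by rewrite -(prednK q0) expnS leq_pmul2l // ltnW.
have [|H [HA HB]] := good_matrix (card_small_sets n t) rlow (q := q).
  apply: leq_trans room; rewrite expnD.
  have -> : 16 * V ^ 2 * f = 2 * (4 * V * (2 * f) * V) by ring.
  by do !apply: leq_mul => //.
have [e eI] : exists e : 'I_f -> 'rV['F_2]_q, injective e.
  have ce : f <= #|{: 'rV['F_2]_q}| by rewrite card_mx card_Fp // mul1n.
  by exists (fun i => enum_val (widen_ord ce i)); move=> i j /enum_val_inj [] /ord_inj.
exists r, (fun c y => support_set (row_mx y (e c) *m H)%R); split=> //.
- move=> J h c c' Jt hJ.
  (* a linear relation among the columns in J would be a vector of weight at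
     most t annihilated by the upper block *)
  have onto (u : 'rV['F_2]_n) : exists y : 'rV['F_2]_r,
      forall j, j \in J -> ((y *m usubmx H) 0 j = u 0 j)%R.
    pose D : 'M['F_2]_n := diag_mx (\row_j (j \in J)%:R)%R.
    have DE m (A : 'M['F_2]_(m, n)) i j : ((A *m D) i j = A i j * (j \in J)%:R)%R.
      by rewrite mul_mx_diag !mxE.
    have : ((u *m D)%R <= (usubmx H *m D)%R)%MS.
      rewrite submxE; set C := cokermx _.
      suff DC0 : (D *m C = 0)%R by rewrite -mulmxA DC0 mulmx0.
      apply/trmx_inj/row_matrixP => j; rewrite trmx0 row0.
      apply/eqP; apply: contraT => s0.
      have s_small : #|support_set (row j (D *m C)^T)%R| <= t.
        apply: leq_trans Jt; apply: subset_leq_card; apply/subsetP => i.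
        rewrite inE !mxE; apply: contraR => iJ; rewrite big1 // => l _.
        by rewrite !mxE; case: eqP => [<-|_]; rewrite ?mulr0n ?mul0r // (negbTE iJ) mul0r.
      have /negP[] := HA _ s0 s_small; apply/eqP.
      by rewrite -tr_col trmxK colE mulmxA (mulmxA (usubmx H) D C) mulmx_coker mul0mx.
    move/submxP => [y yE]; exists y => j jJ.
    by have := DE _ u 0%R j; rewrite yE mulmxA DE jJ !mulr1 => ->.
  have [y0 y0E] := onto ((e c - e c') *m dsubmx H)%R.
  rewrite [RHS](reindex_inj (addIr y0)); apply: eq_bigr => y _; apply: hJ.
  apply/setP => j; rewrite !inE; case: (boolP (j \in J)) => jJ; rewrite ?andbF // !andbT.
  rewrite -[H]vsubmxK !mul_row_col mulmxDl -addrA ![in RHS]mxE.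
  have := y0E j jJ; rewrite mulmxBl mxE => ->; rewrite !mxE.
  by rewrite subrK.
- move=> c y c' y'; rewrite symdiff_support -mulmxBl => le.
  have E : (row_mx y (e c) - row_mx y' (e c') = 0)%R.
    by apply/eqP; apply: contraT => /HB; rewrite ltnNge le.
  by move/eqP: E; rewrite subr_eq0 => /eqP/eq_row_mx[-> /eI ->].
Qed.

(** * The gadget *)

Lemma card_split_draws (V : finType) (B a : {set V}) (t j : nat) : j <= t ->
  #|[set e : {set V} | (e \subset B) && (#|e| == t) && (#|e :&: a| == j)]| =
  'C(#|B :&: a|, j) * 'C(#|B :\: a|, t - j).
Proof.
move=> jt; rewrite -!cards_draws -cardsX.
have sI : injective (fun e : {set V} => (e :&: a, e :\: a)).
  by move=> e e' [E1 E2]; rewrite -(setID e a) E1 E2 setID.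
rewrite -[LHS](card_imset _ sI); apply: eq_card => -[x y]; rewrite !inE /=.
apply/imsetP/andP => [[e]|[/andP[xB xj] /andP[yB yj]]].
  rewrite inE => /andP[/andP[eB et] ej] [-> ->]; rewrite setSI // setSD // ej.
  by split=> //; move: et; rewrite -(cardsID a e) (eqP ej) => /eqP <-; rewrite addKn eqxx.
have xa : x \subset a by apply: subset_trans xB (subsetIr _ _).
have ya : y :&: a = set0.
  by apply/setP => z; rewrite !inE; apply/andP => -[/(subsetP yB)]; rewrite inE => /andP[/negP].
have Ea : (x :|: y) :&: a = x by rewrite setIUl ya setU0; apply/setIidPl.
have Ed : (x :|: y) :\: a = y.
  rewrite setDUl (_ : x :\: a = set0) ?set0U; last by apply/eqP; rewrite setD_eq0.
  by apply/setDidPl; rewrite -setI_eq0 ya.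
exists (x :|: y); last by rewrite Ea Ed.
rewrite inE Ea xj -(cardsID a (x :|: y)) Ea Ed (eqP xj) (eqP yj) subnKC // eqxx !andbT.
by rewrite subUset (subset_trans xB (subsetIl _ _)) (subset_trans yB (subsetDl _ _)).
Qed.

Lemma card_lt_ord m n : m <= n -> #|[pred i : 'I_n | i < m]| = m.
Proof.
move=> mn; rewrite -sum1_card -[RHS]card_ord -[RHS]sum1_card.
by rewrite (big_ord_widen n (fun=> 1) mn); apply: eq_bigl.
Qed.

Section Gadget.
Variables (V : finType) (t K n : nat) (a base : {set V}) (p : 'I_n -> V) (partner : V -> V).
Let k := K + t.
Hypotheses (a_t : #|a| = t) (card_base : #|base| = k + t) (a_base : a \subset base).
Hypotheses (p_inj : injective p) (p_base : forall i, p i \in base).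
Hypotheses (p_a : forall i, p i \notin a) (partner_base : forall i, partner (p i) \notin base).
Hypothesis partnerK : involutive partner.
Implicit Types (w : {set 'I_n}) (e b : {set V}).

(** The twin of a point of w is exchanged too, so that this is an involution;
    [sub_block] then moves a switch from a block to the sets contained in it. *)
Definition switch w z := if (z \in p @: w) || (partner z \in p @: w) then partner z else z.

Lemma switchK w : involutive (switch w).
Proof.
by move=> z; rewrite {2}/switch; case: ifP => h; rewrite /switch ?partnerK ?h // orbC h.
Qed.

Lemma switch_inj w : injective (switch w).
Proof. exact: inv_inj (switchK w). Qed.

Lemma mem_p w i : (p i \in p @: w) = (i \in w).
Proof. exact: mem_imset. Qed.

Lemma partner_notin w i : partner (p i) \in p @: w = false.
Proof.
by apply/negP => /imsetP[j _ E]; have := partner_base i; rewrite E p_base.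
Qed.

Lemma switch_p w i : switch w (p i) = if i \in w then partner (p i) else p i.
Proof. by rewrite /switch mem_p partner_notin orbF. Qed.

Lemma switch_partner w i : switch w (partner (p i)) = if i \in w then p i else partner (p i).
Proof. by rewrite /switch partnerK partner_notin mem_p. Qed.

Lemma switch_id w z : z \in base -> switch w z \in base -> switch w z = z.
Proof.
move=> zO; rewrite /switch; case: ifP => // /orP[] /imsetP[i _ E].
  by rewrite E => h; have := partner_base i; rewrite h.
by move=> _; have := partner_base i; rewrite -E partnerK zO.
Qed.

Lemma mem_switch w (B : {set V}) z : (z \in switch w @: B) = (switch w z \in B).
Proof. by rewrite -{1}(switchK w z) mem_imset //; apply: switch_inj. Qed.

Definition block w e := switch w @: (base :\: e).

Lemma card_block w e : e \subset base -> #|e| = t -> #|block w e| = k.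
Proof.
move=> eO et; rewrite card_imset; last exact: switch_inj.
by rewrite cardsDS // card_base et addnK.
Qed.

Lemma sub_block w e b : (b \subset block w e) = (switch w @: b \subset base :\: e).
Proof.
apply/subsetP/subsetP => H z.
  by move=> /imsetP[y /H]; rewrite mem_switch => h ->.
by move=> zb; rewrite mem_switch; apply: H; apply: imset_f.
Qed.

(** The coordinates on which membership of b in a switched block depends;
    there are at most #|b| of them, which is why agreement on t coordinates is
    enough for the degrees of t-sets. *)
Definition touched b := [set i | (p i \in b) || (partner (p i) \in b)].

Lemma card_touched b : #|touched b| <= #|b|.
Proof.
pose h i := if p i \in b then p i else partner (p i).
have hI : injective h.
  move=> i j; rewrite /h; case: ifP => _; case: ifP => _.
  - exact: p_inj.
  - by move=> E; have := partner_base j; rewrite -E p_base.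
  - by move=> E; have := partner_base i; rewrite E p_base.
  - by move/(inv_inj partnerK); apply: p_inj.
rewrite -(card_imset _ hI); apply: subset_leq_card; apply/subsetP => x /imsetP[i iT ->].
by move: iT; rewrite inE /h; case: ifP.
Qed.

Lemma switch_touched w w' b :
  w :&: touched b = w' :&: touched b -> switch w @: b = switch w' @: b.
Proof.
move=> E; have wE i : i \in touched b -> (i \in w) = (i \in w').
  by move=> iT; have /setP/(_ i) := E; rewrite !in_setI iT !andbT.
have mem1 (u u' : {set 'I_n}) z : (forall i, i \in touched b -> (i \in u) = (i \in u')) ->
    (z \in b) || (partner z \in b) -> z \in p @: u -> z \in p @: u'.
  move=> uu zb /imsetP[i iu zi]; rewrite zi mem_p -uu //.
  by rewrite inE -zi.
have mem2 z : (z \in b) || (partner z \in b) -> (z \in p @: w) = (z \in p @: w').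
  by move=> zb; apply/idP/idP; apply: mem1 => // i /wE.
apply: eq_in_imset => z zb; rewrite /switch !mem2 ?zb // partnerK zb orbT //.
Qed.

Lemma switch_a w z : z \in a -> switch w z = z.
Proof.
move=> za; rewrite /switch; case: ifP => // /orP[] /imsetP[i _ E].
  by have := p_a i; rewrite -E za.
by have := partner_base i; rewrite -E partnerK (subsetP a_base _ za).
Qed.

Lemma switch_eq_a w b : (switch w @: b == a) = (b == a).
Proof.
have aE : switch w @: a = a.
  by rewrite -[RHS]imset_id; apply: eq_in_imset => z; apply: switch_a.
by rewrite -{1}aE (inj_eq (imset_inj (@switch_inj w))).
Qed.

(** The hole can be read off a block: its elements are the points missing
    together with their twins. *)
Lemma block_hole w e z : e \subset base -> z \in base ->
  (z \notin e) = (z \in block w e) || ((z \in codom p) && (partner z \in block w e)).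
Proof.
move=> eO zO; apply/idP/idP => [ze|/orP[]].
- have zOe : z \in base :\: e by rewrite inE ze zO.
  have [/codomP[i zi]|/codomP np] := boolP (z \in codom p).
    rewrite !mem_switch zi switch_p switch_partner /=.
    by case: ifP => _; rewrite -zi zOe ?orbT.
  have [h|h] := boolP ((z \in p @: w) || (partner z \in p @: w)); last first.
    by rewrite mem_switch /switch (negbTE h) zOe.
  case/orP: h => /imsetP[i _ E]; first by case: np; exists i.
  by have := partner_base i; rewrite -E partnerK zO.
- rewrite mem_switch inE => /andP[h tO].
  by rewrite (switch_id zO tO) in h.
- case/andP=> /codomP[i zi]; rewrite mem_switch zi switch_partner inE => /andP[].
  by case: ifP => // _ _ h; have := partner_base i; rewrite h.
Qed.

Lemma block_hole_inj w w' e e' : e \subset base -> e' \subset base ->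
  block w e = block w' e' -> e = e'.
Proof.
move=> eO eO' E; apply/setP => z; have [zO|zO] := boolP (z \in base); last first.
  by rewrite (negbTE (contra (subsetP eO _) zO)) (negbTE (contra (subsetP eO' _) zO)).
by apply: negb_inj; rewrite (block_hole w eO zO) (block_hole w' eO' zO) E.
Qed.

(** Outside the hole the word can be read off the block, and the hole has
    only t points; so words at distance more than t give distinct blocks. *)
Lemma block_word_diff w w' e : block w e = block w' e -> #|symdiff w w'| <= #|e|.
Proof.
have one_side u u' i : block u e = block u' e -> i \in u -> i \notin u' -> p i \in e.
  move=> E iu iu'; apply: contraT => pe.
  have : switch u (p i) \in block u' e by rewrite -E mem_switch switchK inE pe p_base.
  by rewrite switch_p iu mem_switch switch_partner (negbTE iu') inE (negbTE (partner_base i)) andbF.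
move=> E; rewrite -(card_imset _ p_inj); apply: subset_leq_card.
apply/subsetP => _ /imsetP[i] /setUP[] /setDP[i1 i2] ->.
  exact: one_side E i1 i2.
by apply: one_side i1 i2.
Qed.

Variables (L f : nat) (Y : finType) (w : 'I_f -> Y -> {set 'I_n}).
Hypotheses (L0 : 0 < L) (LP : forall j, j <= t -> 'C(t, j) %| L).
Hypotheses (t0 : 0 < t) (tK : t <= K) (f0 : 0 < f).
Hypothesis weight_f : forall j, j <= t -> hole_weight t K L j <= f.
Hypothesis w_trade : forall (J : {set 'I_n}) (h : {set 'I_n} -> int) c c', #|J| <= t ->
  (forall x x', x :&: J = x' :&: J -> h x = h x') ->
  (\sum_y h (w c y) = \sum_y h (w c' y))%R.
Hypothesis w_far : forall c y c' y', #|symdiff (w c y) (w c' y')| <= t -> (c, y) = (c', y').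

Local Open Scope ring_scope.

(** A hole e avoiding b with j points in a is a j-subset of a outside b
    together with t - j points outside a and b; their numbers turn the sum into
    that of [hole_weight_orthogonal]. *)
Lemma hole_sum b : #|b| = t ->
  \sum_(e : {set V} | (e \subset base) && (#|e| == t))
     (-1) ^+ #|e :&: a| * (hole_weight t K L #|e :&: a| * (b \subset base :\: e))%:R =
  ((b == a) * (L * 'C(k, t)))%:R :> int.
Proof.
move=> bt; have [bO|bO] := boolP (b \subset base); last first.
  have -> : (b == a) = false by apply: contraNF bO => /eqP ->.
  rewrite mul0n big1 // => e _; rewrite (_ : b \subset _ = false) ?muln0 ?mulr0 //.
  by apply: contraNF bO => /subset_trans; apply; apply: subsetDl.
set B := base :\: b; set s := #|B :&: a|.
have bE e : e \subset base -> (b \subset base :\: e) = (e \subset B).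
  by move=> eO; rewrite !subsetD bO eO /= disjoint_sym.
have aB : B :&: a = a :\: b.
  by rewrite setIDAC setIC (setIidPl a_base).
have st : (s <= t)%N by rewrite /s aB -a_t subset_leq_card // subsetDl.
have sK : #|B :\: a| = (k - s)%N.
  have := cardsID a B; rewrite -/s => E.
  have : #|B| = k by rewrite /B cardsDS // card_base bt addnK.
  by rewrite -E => <-; rewrite addKn.
have s0 : (s == 0%N) = (b == a).
  rewrite /s aB cards_eq0 setD_eq0 eq_sym eqEcard bt a_t leqnn andbT //.
have -> : \sum_(e : {set V} | (e \subset base) && (#|e| == t))
     (-1) ^+ #|e :&: a| * (hole_weight t K L #|e :&: a| * (b \subset base :\: e))%:R =
   \sum_(e : {set V} | (e \subset B) && (#|e| == t))
     (-1) ^+ #|e :&: a| * (hole_weight t K L #|e :&: a|)%:R :> int.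
  rewrite big_mkcond [RHS]big_mkcond /=; apply: eq_bigr => e _.
  have [eO|eO] := boolP (e \subset base); last first.
    by rewrite (negbTE (contra (fun h => subset_trans h (subsetDl _ _)) eO)).
  rewrite bE //=; case: (e \subset B); case: (#|e| == t) => //=; rewrite ?muln1 ?muln0 ?mulr0 //.
rewrite (partition_big (fun e : {set V} => inord #|e :&: a| : 'I_s.+1) predT) //=.
rewrite -s0 -(hole_weight_orthogonal L0 LP _ tK st); last exact: leq_trans t0 tK.
apply: eq_bigr => j _; have jt : (j <= t)%N by apply: leq_trans st; rewrite -ltnS.
rewrite (eq_bigl (fun e => e \in [set e : {set V} | (e \subset B) && (#|e| == t) && (#|e :&: a| == j)])).
  rewrite (eq_bigr (fun=> (-1) ^+ j * (hole_weight t K L j)%:R)) => [|e]; last first.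
    by rewrite inE => /andP[_ /eqP ->].
  rewrite sumr_const card_split_draws // -/s sK -mulrnAr -mulrnA.
  by rewrite /k.
move=> e; rewrite !inE; case: (boolP (e \subset B)) => //= eB; congr (_ && _).
have le : (#|e :&: a| < s.+1)%N by rewrite ltnS; apply: subset_leq_card; apply: setSI.
by rewrite -val_eqE /= inordK.
Qed.

(** A hole together with one of the copies of its block: c numbers the copies,
    as many as the weight prescribes, and y runs through the words of family c. *)
Definition hole_index (x : {set V} * 'I_f * Y) :=
  [&& x.1.1 \subset base, #|x.1.1| == t & (x.1.2 < hole_weight t K L #|x.1.1 :&: a|)%N].
Definition block_at (x : {set V} * 'I_f * Y) := block (w x.1.2 x.2) x.1.1.
(** o is the parity of the number of points of a in the hole: o = true selects
    the blocks of negative weight. *)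
Definition signed_index (o : bool) := [set x | hole_index x && (odd #|x.1.1 :&: a| == o)].
Definition Pos := block_at @: signed_index false.
Definition Neg := block_at @: signed_index true.

Lemma block_at_inj : {in hole_index &, injective block_at}.
Proof.
move=> [[e c] y] [[e' c'] y']; rewrite /hole_index /block_at !unfold_in /=.
move=> /and3P[eO /eqP et _] /and3P[eO' _ _] E.
have ee := block_hole_inj eO eO' E; rewrite -ee in E *.
by have := block_word_diff E; rewrite et => /w_far[-> ->].
Qed.

Lemma deg_signed o b :
  deg (block_at @: signed_index o) b = (\sum_(x in signed_index o) (b \subset block_at x))%N.
Proof.
rewrite degE big_imset //= => x x'; rewrite !inE => /andP[vx _] /andP[vx' _].
exact: block_at_inj.
Qed.

(** A t-set b lies in a switched block if and only if its switched image lies in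
    the unswitched one.  As all families of words agree on the coordinates
    touched by b, family c may be replaced by a fixed one; then, for each word,
    [hole_sum] applies to the switched image of b, which equals a if and only if
    b does, because a contains no exchanged point. *)
Lemma deg_Pos_Neg b : #|b| = t ->
  (deg Pos b = deg Neg b + L * 'C(k, t) * #|Y| * (b == a))%N.
Proof.
move=> bt; suff : (deg Pos b)%:R - (deg Neg b)%:R = (L * 'C(k, t) * #|Y| * (b == a))%:R :> int.
  by move/eqP; rewrite subr_eq addrC -natrD eqr_nat => /eqP.
pose c0 := Ordinal f0.
have sgn : (deg Pos b)%:R - (deg Neg b)%:R =
    \sum_(x | hole_index x) (-1) ^+ #|x.1.1 :&: a| * (b \subset block_at x)%:R :> int.
  rewrite !deg_signed !natr_sum [RHS](bigID (fun x => odd #|x.1.1 :&: a| == false)) /=.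
  rewrite -sumrN; congr (_ + _); apply: eq_big => x; rewrite !inE.
  - by [].
  - by move=> /andP[_ /eqP o]; rewrite -signr_odd o expr0 mul1r.
  - by case: (odd _).
  - by move=> /andP[_ /eqP o]; rewrite -signr_odd o expr1 mulN1r.
rewrite sgn.
transitivity (\sum_(y : Y) \sum_(e : {set V} | (e \subset base) && (#|e| == t))
     (-1) ^+ #|e :&: a| * (hole_weight t K L #|e :&: a| * (switch (w c0 y) @: b \subset base :\: e))%:R : int); last first.
  rewrite (eq_bigr (fun=> ((b == a) * (L * 'C(k, t)))%:R)) => [|y _].
    by rewrite sumr_const -mulrnA (eq_card (_ : _ =i Y)) //; congr (_%:R); ring.
  by rewrite hole_sum ?switch_eq_a // card_imset //; apply: switch_inj.
rewrite exchange_big /= [RHS]big_mkcond.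
transitivity (\sum_e \sum_c \sum_y if hole_index (e, c, y) then
   (-1) ^+ #|e :&: a| * (b \subset block_at (e, c, y))%:R else 0 : int).
  by rewrite big_mkcond !pair_bigA; apply: eq_bigr => -[[e c] y] _.
apply: eq_bigr => e _; rewrite /hole_index /=; case: ifP => [/andP[eO /eqP et]|no]; last first.
  by rewrite big1 // => c _; rewrite big1 // => y _; rewrite andbA no.
have jt : (#|e :&: a| <= t)%N by rewrite -et subset_leq_card // subsetIl.
rewrite (eq_bigr (fun c : 'I_f => if (c < hole_weight t K L #|e :&: a|)%N then
    (-1) ^+ #|e :&: a| * \sum_y (switch (w c0 y) @: b \subset base :\: e)%:R else 0)) => [|c _]; last first.
  rewrite eO et eqxx /=; case: ifP => _; last by rewrite big1.
  rewrite -mulr_sumr; congr (_ * _).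
  rewrite -(w_trade (J := touched b) (h := fun u => (switch u @: b \subset base :\: e)%:R) c).
  - by apply: eq_bigr => y _; rewrite /block_at sub_block.
  - by rewrite -bt card_touched.
  - by move=> u u' /switch_touched ->.
rewrite -big_mkcond /= sumr_const.
have -> : #|[pred c : 'I_f | (c < hole_weight t K L #|e :&: a|)%N]| = hole_weight t K L #|e :&: a|.
  by rewrite card_lt_ord ?weight_f.
rewrite -mulrnAr -mulr_sumr; congr (_ * _).
by rewrite -sumrMnl; apply: eq_bigr => y _; rewrite -mulrnA mulnC.
Qed.

Local Open Scope nat_scope.

Lemma card_Pos_Neg_blocks x : x \in Pos :|: Neg -> #|x| = k.
Proof.
by case/setUP => /imsetP[y]; rewrite inE => /andP[/and3P[eO /eqP et _] _] ->; apply: card_block.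
Qed.

Lemma card_Pos_Neg : #|Pos :|: Neg| <= 'C(k + t, t) * f * #|Y|.
Proof.
apply: (@leq_trans #|[set x | hole_index x]|).
  apply: leq_trans (leq_imset_card block_at _); apply: subset_leq_card.
  by apply/subsetP => x /setUP[] /imsetP[y]; rewrite inE => /andP[vy _] ->; apply: imset_f; rewrite inE.
apply: (@leq_trans #|setX (setX [set e : {set V} | e \subset base & #|e| == t] [set: 'I_f]) [set: Y]|).
  by apply: subset_leq_card; apply/subsetP => x; rewrite !inE => /and3P[-> -> _].
by rewrite !cardsX cards_draws card_base !cardsT card_ord.
Qed.
End Gadget.

(** The points 0, ..., k + t - 1 serve as base, the first t of them as a; the
    points t, ..., k - 1 have the twins k + t, ..., 2k - 1. *)
Lemma gadget_exists v t k : 0 < t -> 42 * t <= k -> 2 * k <= v ->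
  exists (P Q : {set {set 'I_v}}) (a : {set 'I_v}) (mu : nat),
  [/\ #|a| = t, forall x, x \in P :|: Q -> #|x| = k,
      forall b : {set 'I_v}, #|b| = t -> deg P b = deg Q b + mu * (b == a),
      0 < mu <= 16 ^ t * 'C(k, t) * (4 * 'C(k, t))
    & #|P :|: Q| <= 'C(k + t, t) * (16 ^ t * 'C(k, t)) * (4 * 'C(k, t))].
Proof.
move=> t0 tk kv; have tk' : t <= k by lia.
have [L [L0 L16 LP]] := bin_common_multiple t.
pose K := k - t; pose n := k - t; pose f := 16 ^ t * 'C(k, t).
have Kt : K + t = k by rewrite /K subnK.
have f0 : 0 < f by rewrite muln_gt0 expn_gt0 bin_gt0.
have room : 16 * 'C(n + t, t) ^ 2 * f <= 2 ^ n by rewrite Kt; apply: code_length_suffices.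
have [r [w [r4 w_trade w_far]]] := trade_families f0 room.
have v0 : 0 < v by lia.
pose o i : 'I_v := insubd (Ordinal v0) i.
have oE i : i < v -> o i = i :> nat by move=> h; rewrite insubdK.
pose a := [set i : 'I_v | i < t]; pose base := [set i : 'I_v | i < k + t].
pose p (i : 'I_n) : 'I_v := o (t + i).
pose partner (z : 'I_v) : 'I_v := if t <= z < k then o (z + k) else
   if k + t <= z < 2 * k then o (z - k) else z.
have pE i : p i = t + i :> nat by rewrite oE //; have := ltn_ord i; rewrite /n; lia.
have partner_p i : partner (p i) = t + i + k :> nat.
  have := ltn_ord i; rewrite {2}/n => lt.
  by rewrite /partner pE ifT ?oE //; lia.
have card_lt m : m <= v -> #|[set i : 'I_v | i < m]| = m.
  by move=> mv; rewrite cardsE card_lt_ord.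
have a_t : #|a| = t by rewrite card_lt //; lia.
have card_base : #|base| = K + t + t by rewrite card_lt ?Kt //; lia.
have a_base : a \subset base by apply/subsetP => i; rewrite !inE; lia.
have p_inj : injective p by move=> i j /(congr1 val) /=; rewrite !pE => /addnI/val_inj.
have p_base i : p i \in base by rewrite inE pE; have := ltn_ord i; rewrite {2}/n; lia.
have p_a i : p i \notin a by rewrite inE pE; lia.
have partner_base i : partner (p i) \notin base by rewrite inE partner_p; lia.
have partnerE z : partner z = (if t <= z < k then z + k else
    if k + t <= z < 2 * k then z - k else z) :> nat.
  rewrite /partner; have zv := ltn_ord z.
  by case: ifP => h; [rewrite oE //; lia | case: ifP => h' //; rewrite oE //; lia].
have partnerK : involutive partner.
  by move=> z; apply: val_inj; rewrite /= !partnerE; do 4?case: ifP; lia.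
have tK : t <= K by rewrite /K; lia.
have K0 : 0 < K by lia.
have weight_f j : j <= t -> hole_weight t K L j <= f.
  move=> jt; apply: leq_trans (hole_weight_le K L jt) _; by rewrite Kt leq_mul2r L16 orbT.
have cY : #|{: 'rV['F_2]_r}| = 2 ^ r by rewrite card_mx card_Fp // mul1n.
have r4' : 2 ^ r <= 4 * 'C(k, t) by rewrite -Kt.
exists (Pos t K a base p partner L w), (Neg t K a base p partner L w), a, (L * 'C(k, t) * 2 ^ r).
split=> //.
- by move=> x /(card_Pos_Neg_blocks card_base partnerK) ->.
- by move=> b bt; rewrite (deg_Pos_Neg a_t card_base a_base p_inj p_base p_a partner_base
    partnerK L0 LP t0 tK f0 weight_f w_trade w_far bt) Kt cY.
- apply/andP; split; first by rewrite !muln_gt0 L0 bin_gt0 tk' expn_gt0.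
  by apply: leq_mul r4'; rewrite leq_mul2r L16 orbT.
- apply: leq_trans (card_Pos_Neg _ _ _ card_base _ _) _.
  by rewrite Kt cY leq_mul2l r4' orbT.
Qed.

(** * Zero-sum subfamilies modulo m *)

Lemma root_sum_eq0 (m s : nat) (z : algC) : (m.-primitive_root z)%R ->
  ~~ (m %| s) -> (\sum_(j < m) z ^+ (j * s) = 0)%R.
Proof.
move=> zP ms; have zs1 : (z ^+ s != 1)%R by rewrite -(prim_order_dvd zP).
have H : ((z ^+ s - 1) * \sum_(j < m) (z ^+ s) ^+ j = 0)%R.
  by rewrite -subrX1 -exprM mulnC exprM (prim_expr_order zP) expr1n subrr.
move/eqP: H; rewrite mulf_eq0 subr_eq0 (negbTE zs1) /= => /eqP H.
rewrite -[RHS]H; apply: eq_bigr => j _; by rewrite -exprM mulnC.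
Qed.

Section Chars.
Variables (A I : finType) (m : nat) (x : I -> A -> nat) (z : algC).
Hypothesis zP : (m.-primitive_root z)%R.

Definition char_value (y : {ffun A -> 'I_m}) (i : I) : algC :=
  (z ^+ (\sum_b y b * x i b))%R.

(** The sum over characters factors over the coordinates, and the factor at b
    is a sum of powers of a nontrivial root of unity. *)
Lemma char_sum_eq0 (J : {set I}) (b : A) : ~~ (m %| \sum_(i in J) x i b) ->
  (\sum_(y : {ffun A -> 'I_m}) \prod_(i in J) char_value y i = 0)%R.
Proof.
move=> Hb.
have E (y : {ffun A -> 'I_m}) : (\prod_(i in J) char_value y i =
    \prod_(a : A) z ^+ (y a * \sum_(i in J) x i a))%R.
  rewrite /char_value !prodrXr; congr (_ ^+ _)%R.
  by rewrite exchange_big /=; apply: eq_bigr => a _; rewrite big_distrr.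
under eq_bigr do rewrite E.
rewrite -(bigA_distr_bigA (fun a (j : 'I_m) => z ^+ (j * \sum_(i in J) x i a))%R).
by rewrite (bigD1 b) //= (root_sum_eq0 zP Hb) mul0r.
Qed.

Lemma char_unity (y : {ffun A -> 'I_m}) (i : I) :
  exists j : 'I_m, char_value y i = (z ^+ j)%R.
Proof.
have m0 := prim_order_gt0 zP.
exists (Ordinal (ltn_pmod (\sum_b y b * x i b) m0)).
by rewrite /char_value /= (prim_expr_mod zP).
Qed.

(** Choosing c i as the most frequent value at i among the characters not yet
    matched, at least a fraction 1/m of them gets matched at each step. *)
Lemma few_surviving_chars (s : seq I) : uniq s -> exists c : I -> algC,
  (forall i, c i != 0%R) /\
  #|[set y | [forall i, (i \in s) ==> (char_value y i != c i)]]| * m ^ size s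
   <= m ^ #|A| * m.-1 ^ size s.
Proof.
have m0 := prim_order_gt0 zP.
have z0 : z != 0%R.
  apply/eqP => z0; move: (prim_expr_order zP); rewrite z0 expr0n gtn_eqF //.
  by move/eqP; rewrite eq_sym oner_eq0.
elim: s => [_|i s IH /= /andP[is_ us]].
  exists (fun=> 1%R); split=> [i|]; first exact: oner_neq0.
  rewrite !expn0 !muln1 (leq_trans (max_card _)) // card_ffun card_ord; exact: leqnn.
have {IH}[c [c0 cs]] := IH us.
set Y := [set y | _] in cs.
pose Yj (j : 'I_m) := [set y in Y | char_value y i == z ^+ j]%R.
have cov : #|Y| <= \sum_(j < m) #|Yj j|.
  rewrite (eq_bigr (fun j : 'I_m => \sum_(y in Y) (char_value y i == z ^+ j)%R)); last first.
    move=> j _; rewrite -sum1_card big_mkcond [RHS]big_mkcond /=.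
    by apply: eq_bigr => y _; rewrite inE; case: (y \in Y).
  rewrite exchange_big /= -sum1_card; apply: leq_sum => y _.
  by have [j ->] := char_unity y i; rewrite (bigD1 j) //= eqxx.
have [j Hj] : exists j : 'I_m, #|Y| <= m * #|Yj j|.
  exists [arg max_(j > Ordinal m0) #|Yj j|].
  case: arg_maxnP => //= j _ jmax; apply: leq_trans cov _.
  have: \sum_(l < m) #|Yj l| <= \sum_(l < m) #|Yj j|.
    by apply: leq_sum => l _; apply: jmax.
  by rewrite sum_nat_const card_ord.
exists (fun l => if l == i then z ^+ j else c l)%R; split=> [l|].
  by case: ifP => // _; rewrite expf_neq0.
have le1 : #|[set y | [forall l, (l \in i :: s) ==>
     (char_value y l != (if l == i then z ^+ j else c l)%R)]]| <= #|Y| - #|Yj j|.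
  rewrite -cardsDS; last by apply/subsetP => y; rewrite inE => /andP[].
  apply: subset_leq_card; apply/subsetP => y; rewrite !inE => /forallP H.
  have:= H i; rewrite inE eqxx /= => /negbTE ->; rewrite andbF /=.
  apply/forallP => l; apply/implyP => ls; have := H l.
  rewrite inE ls orbT /=; case: (l =P i) => [li|_ //].
  by rewrite -li ls in is_.
rewrite !expnS.
apply: leq_trans (_ : (#|Y| * m.-1) * m ^ size s <= _).
  rewrite mulnA leq_mul2r; apply/orP; right.
  apply: leq_trans (leq_mul le1 (leqnn m)) _; nia.
by rewrite mulnAC [X in _ <= X]mulnCA [m.-1 * _]mulnC leq_mul2r cs orbT.
Qed.

(** By assumption no character survives in [few_surviving_chars], so the
    product of the c i - y(i) is zero for every character y.  Expand this product and
    sum over y: without a zero-sum subset every term but the one of the empty set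
    cancels, and that term is a nonzero multiple of the product of the c i. *)
Lemma zero_sum_subset : m ^ #|A| * m.-1 ^ #|I| < m ^ #|I| ->
  exists2 J : {set I}, J != set0 & forall b, m %| \sum_(i in J) x i b.
Proof.
move=> big; have [c [c0 cs]] := few_surviving_chars (enum_uniq I).
have kill (y : {ffun A -> 'I_m}) : (\prod_i (c i + - char_value y i) = 0)%R.
  rewrite -cardE in cs.
  have : #|[set y | [forall i, (i \in enum I) ==> (char_value y i != c i)]]| = 0.
    apply/eqP; rewrite -leqn0 leqNgt; apply/negP => pos.
    by have := leq_ltn_trans cs big; rewrite ltnNge => /negP[]; apply: leq_pmull.
  move/eqP; rewrite cards_eq0 => /eqP/setP/(_ y); rewrite !inE => /negbT.
  rewrite negb_forall => /existsP[i]; rewrite mem_enum /= negbK => /eqP E.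
  by rewrite (bigD1 i) //= E subrr mul0r.
have [/existsP[J /andP[J0 /forallP HJ]]|noJ] :=
  boolP [exists J : {set I}, (J != set0) && [forall b, m %| \sum_(i in J) x i b]].
  by exists J.
have : (\sum_(y : {ffun A -> 'I_m}) \prod_i (- char_value y i + c i) = 0)%R.
  by apply: big1 => y _; rewrite -[RHS](kill y); apply: eq_bigr => i _; rewrite addrC.
under eq_bigr do rewrite bigA_distr.
rewrite exchange_big /= (bigD1 set0) //= [X in (_ + X)%R]big1 => [|J J0]; last first.
  have [b Hb] : exists b, ~~ (m %| \sum_(i in J) x i b).
    by move/existsPn/(_ J): noJ; rewrite J0 /= negb_forall => /existsP.
  have split_prod (y : {ffun A -> 'I_m}) :
      (\prod_i (if i \in J then - char_value y i else c i) =
       ((\prod_(i in J) -1) * \prod_(i | i \notin J) c i) * \prod_(i in J) char_value y i)%R.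
    rewrite (bigID (mem J)) /= mulrAC -big_split /=; congr (_ * _)%R.
      by apply: eq_bigr => i ->; rewrite mulN1r.
    by apply: eq_bigr => i /negbTE ->.
  by under eq_bigr do rewrite split_prod; rewrite -big_distrr /= (char_sum_eq0 Hb) mulr0.
rewrite addr0.
under eq_bigr do under eq_bigr do rewrite inE.
move/eqP; rewrite sumr_const card_ffun card_ord -mulr_natr mulf_eq0 pnatr_eq0.
rewrite -leqn0 leqNgt expn_gt0 (prim_order_gt0 zP) /= orbF prodf_seq_eq0.
by move/hasP => [i _ /andP[_ /eqP Hi]]; move: (c0 i); rewrite Hi eqxx.
Qed.
End Chars.

(** m^m >= 2 (m - 1)^m gives the factor 2^(m d) > m^d after m^2 d steps. *)
Lemma pow_pred_lt (m d N : nat) : 0 < m -> 0 < d -> m ^ 2 * d <= N ->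
  m ^ d * m.-1 ^ N < m ^ N.
Proof.
case: m => // -[|m] _ d0 leN; first by rewrite exp0n ?muln0 ?exp1n //; lia.
have bern : 2 * m.+1 ^ m.+2 <= m.+2 ^ m.+2.
  rewrite [X in _ <= X ^ _](_ : m.+2 = 1 + m.+1) // expnDn big_ord_recr big_ord_recr /=.
  rewrite !exp1n !mul1n binn mul1n mul2n -addnn -addnA -[X in X <= _]add0n.
  by rewrite leq_add // leq_add2r binSn expnS leq_mul2r leqnSn orbT.
have step : m.+2 ^ d * m.+1 ^ (m.+2 ^ 2 * d) < m.+2 ^ (m.+2 ^ 2 * d).
  apply: leq_trans (_ : (2 * m.+1 ^ m.+2) ^ (m.+2 * d) <= _); last first.
    by rewrite -mulnn -mulnA [X in _ <= X]expnM leq_exp2r // muln_gt0 d0.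
  rewrite expnMn -[in X in _ < X]expnM mulnA mulnn ltn_pmul2r ?expn_gt0 //.
  by rewrite expnM ltn_exp2r // ltn_expl.
move: leN step; rewrite -[m.+2.-1]/(m.+1); move: (m.+2 ^ 2 * d) => e leN step.
rewrite -(subnKC leN) !expnD mulnA.
apply: (@leq_ltn_trans (m.+2 ^ d * m.+1 ^ e * m.+2 ^ (N - e))).
  by rewrite leq_mul2l; apply/orP; right; case: (N - e) => [|q]; rewrite // leq_exp2r.
by rewrite ltn_pmul2r // expn_gt0.
Qed.

Lemma exists_zero_sum (A I : finType) (m : nat) (x : I -> A -> nat) (S : {set I}) :
  0 < m -> 0 < #|A| -> m ^ 2 * #|A| <= #|S| ->
  exists J : {set I}, [/\ J \subset S, J != set0 & forall b, m %| \sum_(i in J) x i b].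
Proof.
move=> m0 A0 big; have [z zP] := C_prim_root_exists m0.
have [|J J0 HJ] := @zero_sum_subset A {i | i \in S} m (fun i => x (val i)) z zP.
  apply: pow_pred_lt => //; rewrite card_sig; apply: leq_trans big _.
  by apply: subset_leq_card; apply/subsetP => i.
exists (val @: J); split.
- by apply/subsetP => _ /imsetP[[i iS] _ ->].
- by apply: contraNneq J0 => /eqP; rewrite imset_eq0.
- by move=> b; rewrite big_imset //= => i j _ _; apply: val_inj.
Qed.

(** A largest zero-sum subfamily J cannot leave out many elements: the
    complement would contain another one, to be joined to J. *)
Lemma trim_zero_sum (A I : finType) (m : nat) (x : I -> A -> nat) :
  0 < m -> 0 < #|A| ->
  exists2 J : {set I}, #|~: J| < m ^ 2 * #|A| & forall b, m %| \sum_(i in J) x i b.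
Proof.
move=> m0 A0.
pose ok (J : {set I}) := [forall b, m %| \sum_(i in J) x i b].
have ok0 : ok set0 by apply/forallP => b; rewrite big_set0.
case: (@arg_maxnP _ set0 ok (fun J => #|J|) ok0) => J /forallP okJ Jmax.
exists J => //; rewrite ltnNge; apply/negP => big.
have [K [KJ K0 HK]] := exists_zero_sum x m0 A0 big.
have dJK : [disjoint J & K] by rewrite disjoints_subset -setCS setCK.
have : #|J :|: K| <= #|J|.
  apply: Jmax; apply/forallP => b.
  rewrite (eq_bigl [predU J & K]) => [|i]; last by rewrite !inE.
  by rewrite bigU //= dvdn_add.
rewrite cardsU disjoint_setI0 // cards0 subn0 -[X in _ <= X]addn0 leq_add2l.
by rewrite leqn0 cards_eq0 (negbTE K0).
Qed.

(** * Greedy choice with small deviation *)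

Section Greedy.
Variables (I Omega A : finType) (options : I -> {set Omega}) (F : Omega -> A -> nat).
Variables (conflict : rel Omega) (g kappa : nat).
Hypothesis F_le : forall w b, F w b <= g.
Hypothesis conflictC : symmetric conflict.
Hypothesis conflict_le : forall i w', #|[set w in options i | conflict w' w]| <= kappa.
Hypothesis options_big : forall i, kappa * #|I| * (1 + #|A| * #|I| * g ^ 2) < #|options i|.

Definition mean (i : I) (b : A) : rat :=
  ((\sum_(w in options i) (F w b)%:R) / #|options i|%:R)%R.

Definition dev (i : I) (w : Omega) (b : A) : rat := ((F w b)%:R - mean i b)%R.

Local Open Scope ring_scope.

Lemma options_gt0 i : (0 : rat) < #|options i|%:R.
Proof. by rewrite ltr0n (leq_ltn_trans _ (options_big i)). Qed.

Lemma dev_sum i b : \sum_(w in options i) dev i w b = 0.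
Proof.
rewrite /dev sumrB sumr_const -mulr_natr /mean divfK ?subrr //.
by rewrite gt_eqF // options_gt0.
Qed.

Lemma dev_le i w b : `|dev i w b| <= g%:R.
Proof.
have m0 : 0 <= mean i b by apply: divr_ge0 => //; apply: sumr_ge0.
have mg : mean i b <= g%:R.
  rewrite ler_pdivrMr ?options_gt0 // mulr_natr -sumr_const.
  by apply: ler_sum => w' _; rewrite ler_nat.
have := F_le w b; rewrite -(ler_nat rat) => F1.
have F0 : 0 <= (F w b)%:R :> rat by [].
by rewrite /dev ler_norml; apply/andP; split; lra.
Qed.

(** The deviations of the options for i have mean zero, so their products with
    E do as well.  The excluded options are too few to compensate a product of
    more than 1 for all the others. *)
Lemma greedy_step (E : A -> rat) (l : seq Omega) (i : I) :
  (forall b, `|E b| <= (#|I| * g)%:R) -> (size l <= #|I|)%N ->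
  exists2 w, (w \in options i) && all (fun w' => ~~ conflict w' w) l
     & \sum_b E b * dev i w b <= 1.
Proof.
move=> HE sl; set X : rat := (#|A| * #|I| * g ^ 2)%:R.
have xiX w : `|\sum_b E b * dev i w b| <= X.
  apply: le_trans (ler_norm_sum _ _ _) _.
  apply: le_trans (_ : \sum_(b : A) (#|I| * g)%:R * g%:R <= _).
    by apply: ler_sum => b _; rewrite normrM ler_pM // dev_le.
  rewrite sumr_const -natrM -mulrnA ler_nat (eq_card (_ : _ =i A)) //.
  by apply: eq_leq; ring.
pose good w := all (fun w' => ~~ conflict w' w) l.
have [/existsP[u /andP[uG ux]]|no] :=
  boolP [exists u, ((u \in options i) && good u) && (\sum_b E b * dev i u b <= 1)].
  by exists u.
have bad_le : (#|[set w in options i | ~~ good w]| <= kappa * #|I|)%N.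
  apply: leq_trans (_ : (kappa * size l <= _)%N); last by rewrite leq_mul2l sl orbT.
  rewrite /good; elim: l {sl no good} => [|w' l IH] /=.
    by rewrite (_ : [set w in _ | _] = set0) ?cards0 //; apply/setP => w; rewrite !inE andbF.
  apply: leq_trans (_ : (#|[set w in options i | conflict w' w]| + _ <= _)%N); last first.
    by rewrite mulnS; apply: leq_add (conflict_le i w') IH.
  apply: leq_trans (leq_card_setU _ _); apply: subset_leq_card; apply/subsetP => w.
  by rewrite !inE negb_and negbK => /andP[-> /orP[]->]; rewrite ?orbT.
have S0 : \sum_(w in options i) \sum_b E b * dev i w b = 0.
  rewrite exchange_big /=; apply: big1 => b _.
  by rewrite -big_distrr /= dev_sum mulr0.
(* if no option qualifies, the product exceeds 1 on all conflict-free options;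
   it is at least -X on the others *)
have lb : \sum_(w in options i) (1 - (~~ good w)%:R * (1 + X)) <= 0.
  rewrite -[X0 in _ <= X0]S0; apply: ler_sum => w wG; have := xiX w; rewrite ler_norml => /andP[lo _].
  move/existsPn/(_ w): no; rewrite wG /=; case: (good w) => /=.
    by rewrite -ltNge mul0r subr0 => /ltW.
  by move=> _; rewrite mul1r opprD addrA subrr sub0r.
have cnt : \sum_(w in options i) (~~ good w)%:R = #|[set w in options i | ~~ good w]|%:R :> rat.
  rewrite -sum1_card natr_sum [LHS]big_mkcond [RHS]big_mkcond /=.
  by apply: eq_bigr => w _; rewrite inE; case: (w \in options i) (good w) => [] [].
move: lb; rewrite sumrB sumr_const -mulr_suml cnt => lb.
have := options_big i; rewrite -(ltr_nat rat) natrM natrD -/X => big.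
have bad_le' : #|[set w in options i | ~~ good w]|%:R * (1 + X) <= (kappa * #|I|)%:R * (1 + X).
  by rewrite ler_wpM2r ?ler_nat // addr_ge0.
lra.
Qed.

(** Each step adds at most 2 + #|A| g^2 to the sum of squares: the cross term is
    at most 2 by [greedy_step].  Independent random choices would do the same on
    average. *)
Lemma greedy_choice : exists p : I -> Omega,
  [/\ forall i, p i \in options i,
      forall i j, i != j -> ~~ conflict (p i) (p j)
    & \sum_b (\sum_i dev i (p i) b) ^+ 2 <= (#|I| * (2 + #|A| * g ^ 2))%:R].
Proof.
suff H (l : seq I) : uniq l -> exists p : I -> Omega,
  [/\ forall i, p i \in options i,
      {in l &, forall i j, i != j -> ~~ conflict (p i) (p j)}
    & \sum_b (\sum_(i <- l) dev i (p i) b) ^+ 2 <= (size l * (2 + #|A| * g ^ 2))%:R].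
  have [p [p1 p2 p3]] := H _ (enum_uniq I); exists p; split=> //.
    by move=> i j; apply: p2; rewrite mem_enum.
  rewrite -cardE in p3; apply: le_trans p3.
  by under [X in _ <= X]eq_bigr do rewrite big_enum.
elim: l => [_|i l IH /= /andP[il ul]].
  have : forall i, exists w, w \in options i.
    by move=> i; apply/set0Pn; rewrite -card_gt0 (leq_ltn_trans _ (options_big i)).
  case/fin_all_exists => p pG; exists p; split=> //.
  by rewrite mul0n big1 // => b _; rewrite big_nil expr0n.
have {IH}[p [p1 p2 p3]] := IH ul.
have sl : (size l <= #|I|)%N by rewrite -(card_uniqP ul) max_card.
pose E b := \sum_(j <- l) dev j (p j) b.
have HE b : `|E b| <= (#|I| * g)%:R.
  apply: le_trans (ler_norm_sum _ _ _) _.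
  apply: le_trans (_ : \sum_(j <- l) g%:R <= _); first by apply: ler_sum => j _; apply: dev_le.
  by rewrite big_const_seq iter_addr_0 count_predT -mulrnA ler_nat mulnC leq_mul2r sl orbT.
have [|w /andP[wG /allP wl] wx] := @greedy_step E (map p l) i HE; first by rewrite size_map.
exists (fun j => if j == i then w else p j); split.
- by move=> j; case: eqP => [->|].
- move=> j j'; rewrite !inE.
  have [->|ji] /= := eqVneq j i; have [->|j'i] /= := eqVneq j' i; rewrite ?eqxx //.
  + by move=> _ j'l _; rewrite conflictC; apply: wl; apply: map_f.
  + by move=> jl _ _; apply: wl; apply: map_f.
  + exact: p2.
have -> : \sum_b (\sum_(j <- i :: l) dev j (if j == i then w else p j) b) ^+ 2 =
    \sum_b ((E b) ^+ 2 + 2 * (E b * dev i w b) + (dev i w b) ^+ 2).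
  apply: eq_bigr => b _; rewrite big_cons eqxx.
  rewrite (_ : \sum_(j <- l) _ = E b); first by ring.
  by apply: eq_big_seq => j jl; case: eqP => // ji; rewrite -ji jl in il.
rewrite !big_split /= -big_distrr /= mulSn natrD.
have d2 : \sum_b dev i w b ^+ 2 <= (#|A| * g ^ 2)%:R.
  apply: le_trans (_ : \sum_(b : A) (g%:R) ^+ 2 <= _).
    by apply: ler_sum => b _; rewrite -real_normK ?num_real // ler_sqr ?nnegrE // dev_le.
  by rewrite sumr_const -natrX -mulrnA mulnC (eq_card (_ : _ =i A)).
rewrite -/E in p3; rewrite natrD; lra.
Qed.
End Greedy.

(** * From a gadget to a family of constant degree *)

Section Flip.
Variables (V : finType) (t k : nat) (P Q : {set {set V}}) (a0 : {set V}).
Variables (mu g r s : nat).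
(* r images are planted at each t-set; s bounds the difference of the planted
   degrees, and trimming discards fewer than mu^2 d images. *)
Hypotheses (a0t : #|a0| = t) (PQk : forall x, x \in P :|: Q -> #|x| = k).
Hypothesis degPQ : forall b : {set V}, #|b| = t -> deg P b = deg Q b + mu * (b == a0).
Hypotheses (mu0 : 0 < mu) (PQg : #|P :|: Q| <= g).
Let d := 'C(#|V|, t).
Let N := d * r.
Hypotheses (d0 : 0 < d).
Hypothesis many : g ^ 2 * N * (1 + d * N * g ^ 2) * d < 'C(#|V|, k).
Hypothesis s_big : 4 * (N * (2 + d * g ^ 2)) <= s ^ 2.
Hypothesis r_big : s + mu ^ 2 * d * g <= mu * (r - mu ^ 2 * d).
Hypothesis r_big' : mu ^ 2 * d < r.

Let A := {b : {set V} | #|b| == t}.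
Let I := (A * 'I_r)%type.

Lemma card_A : #|{: A}| = d.
Proof.
rewrite card_sig /d -cardsT -cards_draws; apply: eq_card => b.
by rewrite !inE subsetT.
Qed.

Lemma card_I : #|{: I}| = N.
Proof. by rewrite card_prod card_A card_ord. Qed.

Definition towards (i : I) := [set p : {perm V} | p @: a0 == val i.1].
Definition pdeg (p : {perm V}) (b : A) := deg (perm_family p P) (val b).
Definition clash (p p' : {perm V}) :=
  ~~ [disjoint perm_family p (P :|: Q) & perm_family p' (P :|: Q)].

Lemma pdeg_le p b : pdeg p b <= g.
Proof.
apply: leq_trans PQg; apply: (@leq_trans #|perm_family p P|).
  by apply: subset_leq_card; apply/subsetP => x; rewrite inE => /andP[].
by rewrite card_perm_family subset_leq_card // subsetUl.
Qed.

Lemma card_towards i : #|towards i| * d = #|[set: {perm V}]|.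
Proof. by rewrite -(@card_perm_onto V a0 (val i.1)) a0t ?(eqP (valP i.1)). Qed.

Lemma clash_le i p' :
  #|[set p in towards i | clash p' p]| <= g ^ 2 * (#|[set: {perm V}]| %/ 'C(#|V|, k)).
Proof.
apply: (@leq_trans (\sum_(uw in setX (P :|: Q) (P :|: Q)) #|[set p : {perm V} | p @: uw.1 == p' @: uw.2]|)).
  apply: card_le_sum => p; rewrite inE => /andP[_ /disjointPn[x]].
  move=> /imsetP[w wS ->] /imsetP[u uS E]; exists (u, w); first by rewrite inE uS.
  by rewrite inE /= E.
apply: (@leq_trans (\sum_(uw in setX (P :|: Q) (P :|: Q)) (#|[set: {perm V}]| %/ 'C(#|V|, k)))).
  apply: leq_sum => -[u w]; rewrite inE /= => /andP[uS wS].
  have uk := PQk uS; rewrite -(@card_perm_onto V u (p' @: w)) uk ?mulnK //.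
    by apply: leq_ltn_trans many.
  by rewrite card_imset ?(PQk wS) //; apply: perm_inj.
by rewrite sum_nat_const cardsX leq_mul2r -mulnn leq_mul ?orbT.
Qed.

(** A permutation sending a0 to a given t-set clashes with a given one only if
    it sends some block of the gadget to a prescribed k-set, and this is rarer by
    the factor C(v, t) / C(v, k). *)
Lemma towards_big i :
  g ^ 2 * (#|[set: {perm V}]| %/ 'C(#|V|, k)) * #|{: I}|
    * (1 + #|{: A}| * #|{: I}| * g ^ 2) < #|towards i|.
Proof.
rewrite card_I card_A; set M := #|_| %/ _.
have C0 : 0 < 'C(#|V|, k) by apply: leq_ltn_trans many.
have G0 : 0 < #|[set: {perm V}]|.
  by rewrite card_gt0; apply/set0Pn; exists 1%g; rewrite inE.
have le1 : M * 'C(#|V|, k) <= #|towards i| * d by rewrite card_towards leq_trunc_div.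
have t0 : 0 < #|towards i| by move: G0; rewrite -(card_towards i) muln_gt0 => /andP[].
rewrite -(ltn_pmul2r C0) -(ltn_pmul2r d0).
apply: (@leq_ltn_trans ((g ^ 2 * N * (1 + d * N * g ^ 2) * d) * (#|towards i| * d))).
  apply: leq_trans (leq_mul (leqnn (g ^ 2 * N * (1 + d * N * g ^ 2) * d)) le1).
  by apply: eq_leq; ring.
apply: (@leq_trans ('C(#|V|, k) * (#|towards i| * d))); last by apply: eq_leq; ring.
by rewrite ltn_pmul2r // muln_gt0 t0.
Qed.

Lemma clashC : symmetric clash.
Proof. by move=> p p'; rewrite /clash disjoint_sym. Qed.

(** Composing with a permutation that sends b to b' permutes the t-sets to
    which images are assigned. *)
Lemma mean_sum_const (b b' : A) :
  (\sum_(i : I) mean towards pdeg i b = \sum_(i : I) mean towards pdeg i b')%R.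
Proof.
have [q qb] : exists q : {perm V}, q @: val b = val b'.
  by apply: perm_onto; rewrite (eqP (valP b)) (eqP (valP b')).
pose h : A -> A := fun a => 
  exist _ (q @: val a) (introT eqP (etrans (card_imset _ (@perm_inj _ q)) (eqP (valP a)))).
have hI : injective h.
  move=> a a' /(congr1 val) /= /(imset_inj (@perm_inj _ q)) E; exact: val_inj.
pose h2 (i : I) : I := (h i.1, i.2).
have h2I : injective h2.
  move=> [a j] [a' j'] E; have /= aa' := hI _ _ (congr1 fst E).
  by have /= -> := congr1 snd E; rewrite aa'.
rewrite [RHS](reindex_inj h2I) /=; apply: eq_bigr => i _; rewrite /mean.
have tq : towards (h2 i) = [set (p * q)%g | p in towards i].
  apply/setP => p; rewrite inE /=; apply/eqP/imsetP => [E|[u]].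
    exists (p * q^-1)%g; last by rewrite mulgKV.
    rewrite inE imset_permM E -imset_permM mulgV; apply/eqP.
    by rewrite -[RHS]imset_id; apply: eq_imset => x; rewrite perm1.
  by rewrite inE => /eqP E ->; rewrite imset_permM E.
have mI : injective (fun p : {perm V} => p * q)%g by apply: mulIg.
rewrite tq card_imset // big_imset /=; last by move=> ? ? _ _; apply: mI.
congr (_ / _)%R; apply: eq_bigr => p _; congr (_%:R)%R.
by rewrite /pdeg -qb perm_familyM deg_perm.
Qed.

Lemma fiber_card (b : A) (J : {set I}) :
  r - #|~: J| <= #|[set i in J | i.1 == b]|.
Proof.
have E : #|[set i : I | i.1 == b]| = r.
  rewrite -[RHS](card_ord r) -(@card_imset _ _ (pair b) 'I_r) => [|x y []//].
  apply: eq_card => -[c j]; rewrite inE /=; apply/eqP/imsetP => [->|[j' _ [-> _]]] //.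
  by exists j.
apply: (@leq_trans #|[set i : I | i.1 == b] :\: ~: J|).
  by rewrite cardsD E leq_sub2l // subset_leq_card // subsetIr.
by apply: subset_leq_card; apply/subsetP => i; rewrite !inE negbK andbC.
Qed.

Lemma deg_gadget (p : {perm V}) (i : I) (b : A) : p \in towards i ->
  deg (perm_family p P) (val b) = deg (perm_family p Q) (val b) + mu * (i.1 == b).
Proof.
rewrite inE => /eqP pa.
have [c cb] : exists c : {set V}, val b = p @: c.
  exists (p^-1%g @: val b); rewrite -imset_permM mulVg.
  by rewrite -[LHS]imset_id; apply: eq_imset => x; rewrite perm1.
have ct : #|c| = t by rewrite -(card_imset _ (@perm_inj _ p)) -cb (eqP (valP b)).
rewrite -val_eqE -[X in X == _]/(val i.1) -pa cb !deg_perm degPQ //.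
congr (_ + _ * (_ : bool)); apply/eqP/eqP => [->//|].
by move/(imset_inj (@perm_inj _ p)).
Qed.

(** (x - y)^2 <= 2 x^2 + 2 y^2 for the deviations x and y at b and b'; their
    means agree by [mean_sum_const]. *)
Lemma planted_balanced (p : I -> {perm V}) (b b' : A) :
  (\sum_c (\sum_i dev towards pdeg i (p i) c) ^+ 2
     <= (#|{: I}| * (2 + #|{: A}| * g ^ 2))%:R)%R ->
  \sum_i pdeg (p i) b <= \sum_i pdeg (p i) b' + s.
Proof.
rewrite card_I card_A => pE; set M := N * _ in pE.
pose E c := (\sum_i dev towards pdeg i (p i) c)%R.
have E2 c : (E c ^+ 2 <= M%:R)%R.
  apply: le_trans pE; rewrite (bigD1 c) //= lerDl; apply: sumr_ge0 => ? _.
  exact: sqr_ge0.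
have Es : (E b - E b' <= s%:R)%R.
  have [le0|gt0] := lerP (E b - E b')%R 0%R; first exact: le_trans le0 _.
  rewrite -ler_sqr ?nnegrE ?(ltW gt0) // -natrX.
  apply: le_trans (_ : (4 * M)%:R <= _)%R; last by rewrite ler_nat.
  have := sqr_ge0 (E b + E b')%R; have := E2 b; have := E2 b'; rewrite natrM; nra.
have EE c : (E c = (\sum_i pdeg (p i) c)%:R - \sum_i mean towards pdeg i c)%R.
  by rewrite /E /dev sumrB natr_sum.
by rewrite -(ler_nat rat) natrD; move: Es; rewrite !EE (mean_sum_const b b'); lra.
Qed.

(** After trimming, the degree at b exceeds the least one by mu * D b, with
    D b at most the number of images left at b; flipping D b of them to Q
    removes exactly this excess. *)
Lemma design_from_gadget : exists (T : {set {set V}}) (lam : nat),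
  [/\ forall x, x \in T -> #|x| = k,
      forall b : {set V}, #|b| = t -> deg T b = lam,
      T != set0 & #|T| <= N * g].
Proof.
have [p [pG pcl pE]] := greedy_choice pdeg_le clashC clash_le towards_big.
have A0 : 0 < #|{: A}| by rewrite card_A.
have [J Jc Jz] := trim_zero_sum (fun i => pdeg (p i)) mu0 A0.
rewrite card_A in Jc.
pose W b := \sum_(i in J) pdeg (p i) b.
have W_le b b' : W b <= W b' + (s + mu ^ 2 * d * g).
  have WE c : \sum_i pdeg (p i) c = W c + \sum_(i | i \notin J) pdeg (p i) c.
    by rewrite (bigID (mem J)).
  have := planted_balanced b b' pE; rewrite !WE.
  have : \sum_(i | i \notin J) pdeg (p i) b' <= mu ^ 2 * d * g.
    apply: (@leq_trans (\sum_(i | i \notin J) g)); first by apply: leq_sum => i _; apply: pdeg_le.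
    rewrite sum_nat_const leq_mul2r; apply/orP; right; apply: leq_trans (ltnW Jc).
    by rewrite -(eq_card (A := ~: J)) // => i; rewrite inE.
  lia.
pose a : A := exist _ a0 (introT eqP a0t).
case: (@arg_minnP _ a xpredT W isT) => b0 _ b0min.
pose D b := (W b - W b0) %/ mu.
have DE b : mu * D b = W b - W b0.
  by rewrite mulnC divnK // dvdn_subr ?b0min ?Jz.
have ex_K b : exists K : {set I}, (K \subset [set i in J | i.1 == b]) && (#|K| == D b).
  have Dle : D b <= #|[set i in J | i.1 == b]|.
    apply: leq_trans (fiber_card b J); apply: (@leq_trans (r - mu ^ 2 * d)).
      rewrite -(leq_pmul2l mu0) DE; apply: leq_trans r_big.
      by rewrite leq_subLR; apply: W_le.
    by apply: leq_sub2l; apply: ltnW.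
  exact: subset_of_card Dle.
have {ex_K}[K KP] := fin_all_exists ex_K.
pose F i := if i \in K i.1 then perm_family (p i) Q else perm_family (p i) P.
have FS i : F i \subset perm_family (p i) (P :|: Q).
  by rewrite /F; case: ifP => _; apply: imsetS; rewrite ?subsetUl ?subsetUr.
have Fd i j : i != j -> [disjoint F i & F j].
  move=> ij; have := pcl _ _ ij; rewrite negbK => dij.
  exact: disjointWl (FS i) (disjointWr (FS j) dij).
have degF (b : A) : deg (\bigcup_(i in J) F i) (val b) = W b0.
  have : \sum_(i in J) deg (F i) (val b) + mu * #|K b| = W b.
    rewrite -sum1_card big_distrr /= [X in _ + X](_ : _ = \sum_(i in J) mu * ((i \in K i.1) && (i.1 == b))).
      rewrite -big_split /=; apply: eq_bigr => i _.
      rewrite /pdeg (deg_gadget b (pG i)) /F; case: ifP => _ //=.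
      by rewrite (deg_gadget b (pG i)) muln0 addn0.
    have /andP[/subsetP KJ _] := KP b.
    rewrite big_mkcond [RHS]big_mkcond /=; apply: eq_bigr => i _.
    have [iK|iK] := ifPn; first by have := KJ i iK; rewrite inE => /andP[-> /eqP ib]; rewrite ib iK eqxx.
    by case: (i.1 =P b) => [->|]; rewrite ?(negbTE iK) ?andbF ?muln0; case: ifP.
  have /andP[_ /eqP ->] := KP b; rewrite DE deg_bigcup //.
  by have := b0min b isT; lia.
exists (\bigcup_(i in J) F i), (W b0); split.
- move=> x /bigcupP[i _ /(subsetP (FS i))/imsetP[u uS ->]].
  by rewrite card_imset ?PQk //; apply: perm_inj.
- move=> b bt; exact: (degF (exist _ b (introT eqP bt))).
- have : 0 < #|[set i in J | i.1 == b0]|.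
    by apply: leq_trans (fiber_card b0 J); rewrite subn_gt0 (ltn_trans Jc).
  rewrite card_gt0 => /set0Pn[i]; rewrite inE => /andP[iJ /eqP ib].
  have iK : i \notin K i.1.
    have /andP[_] := KP b0; rewrite /D subnn div0n cards_eq0 => /eqP Kb.
    by rewrite ib Kb inE.
  have : 0 < deg P a0 by rewrite degPQ // eqxx muln1 addn_gt0 mu0 orbT.
  rewrite card_gt0 => /set0Pn[x]; rewrite inE => /andP[xP _].
  apply/set0Pn; exists (p i @: x); apply/bigcupP; exists i => //.
  by rewrite /F (negbTE iK) imset_f.
- apply: (@leq_trans (\sum_(i in J) g)).
    have le x : x \in \bigcup_(i in J) F i -> exists2 i, i \in J & x \in F i.
      by move=> /bigcupP[i]; exists i.
    apply: leq_trans (card_le_sum le) _.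
    apply: leq_sum => i _; apply: leq_trans (subset_leq_card (FS i)) _.
    by rewrite card_perm_family.
  by rewrite sum_nat_const leq_mul2r -card_I max_card orbT.
Qed.
End Flip.

(** * Families of constant degree: complements and general parameters *)

(** The condition for a t-(v, k, lam) design, in terms of t-subsets instead of
    injective t-tuples. *)
Definition deg_regular (V : finType) (t k : nat) (T : {set {set V}}) :=
  (forall x, x \in T -> #|x| = k) /\
  exists lam, forall b : {set V}, #|b| = t -> deg T b = lam.

Lemma deg_regular_all (V : finType) (t k : nat) : t <= #|V| ->
  deg_regular t k [set x : {set V} | #|x| == k].
Proof.
move=> tV; split=> [x|]; first by rewrite inE => /eqP.
set T := [set x | _].
have [b0 /andP[_ /eqP b0t]] : exists B : {set V}, (B \subset [set: V]) && (#|B| == t).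
  by apply: subset_of_card; rewrite cardsT.
exists (deg T b0) => b bt; have [p <-] : exists p : {perm V}, p @: b0 = b.
  by apply: perm_onto; rewrite b0t.
rewrite -{1}(_ : perm_family p T = T) ?deg_perm //.
apply/eqP; rewrite eqEcard card_perm_family leqnn andbT; apply/subsetP => _ /imsetP[x xT ->].
by move: xT; rewrite !inE card_imset //; apply: perm_inj.
Qed.

Section Complement.
Variables (V : finType) (t k : nat) (T : {set {set V}}).
Hypotheses (T_k : forall x, x \in T -> #|x| = k) (tk : t <= k).

(** Double counting of the pairs (z, x) with z in x, outside b, and b in x. *)
Lemma deg_lower (j : nat) : j < t ->
  (exists lam, forall b : {set V}, #|b| = j.+1 -> deg T b = lam) ->
  exists lam, forall b : {set V}, #|b| = j -> deg T b = lam.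
Proof.
move=> jt [lam Hlam]; have kj : 0 < k - j by rewrite subn_gt0 (leq_trans jt).
exists ((#|V| - j) * lam %/ (k - j)) => b bj.
suff <- : deg T b * (k - j) = (#|V| - j) * lam by rewrite mulnK.
have -> : (#|V| - j) * lam = \sum_(z in ~: b) deg T (z |: b).
  rewrite (eq_bigr (fun=> lam)) => [|z]; last first.
    by rewrite inE => zb; apply: Hlam; rewrite cardsU1 zb bj.
  by rewrite sum_nat_const cardsCs setCK bj.
under eq_bigr do rewrite degE.
rewrite exchange_big /= degE big_distrl /=; apply: eq_bigr => x xT.
have [bx|bx] := boolP (b \subset x); last first.
  by rewrite mul0n big1 // => z _; rewrite subUset (negbTE bx) andbF.
rewrite mul1n -(T_k xT) -bj -cardsDS // -sum1_card big_mkcond [RHS]big_mkcond /=.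
by apply: eq_bigr => z _; rewrite !inE subUset sub1set bx andbT; case: (z \in b); case: (z \in x).
Qed.

Lemma deg_levels : (exists lam, forall b : {set V}, #|b| = t -> deg T b = lam) ->
  forall j, j <= t -> exists lam, forall b : {set V}, #|b| = j -> deg T b = lam.
Proof.
move=> Ht j jt; rewrite -(subKn jt); elim: (t - j) => [|i IH]; first by rewrite subn0.
have [it|ti] := ltnP i t; last by move: IH; rewrite (eqP (_ : t - i.+1 == t - i)) //; lia.
by apply: deg_lower; [lia | rewrite subnSK].
Qed.

Definition deg_avoid (b c : {set V}) := #|[set x in T | (b \subset x) && [disjoint c & x]]|.

(** Inclusion-exclusion, one point z of c at a time: the blocks avoiding
    c minus z either avoid z too or contain it. *)
Lemma deg_avoid_levels : (exists lam, forall b : {set V}, #|b| = t -> deg T b = lam) ->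
  forall l j, j + l <= t -> exists lam, forall b c : {set V},
    #|b| = j -> #|c| = l -> [disjoint b & c] -> deg_avoid b c = lam.
Proof.
move=> Ht; elim=> [|l IH] j jl.
  have [|lam Hlam] := deg_levels Ht (j := j); first by rewrite addn0 in jl.
  exists lam => b c bj /eqP; rewrite cards_eq0 => /eqP -> _; rewrite -(Hlam b bj).
  by apply: eq_card => x; rewrite !inE disjoints_subset sub0set andbT.
have [|lam Hlam] := IH j; first by lia.
have [|lam' Hlam'] := IH j.+1; first by lia.
exists (lam - lam') => b c bj cl bc.
have [z zc] : exists z, z \in c by apply/set0Pn; rewrite -card_gt0 cl.
have zb : z \notin b by apply: contraTN zc => zb; rewrite (disjointFr bc).
have cz : #|c :\ z| = l by move: cl; rewrite (cardsD1 z) zc => -[].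
have bcz : [disjoint b & c :\ z] by apply: disjointWr bc; apply: subsetDl.
have d1 : [disjoint z |: b & c :\ z].
  by rewrite disjoints_subset subUset sub1set !inE eqxx /= -disjoints_subset.
rewrite -(Hlam b (c :\ z)) // -(Hlam' (z |: b) (c :\ z)) //; last by rewrite cardsU1 zb bj.
rewrite -cardsDS; last first.
  by apply/subsetP => x; rewrite !inE subUset => /andP[-> /andP[/andP[_ ->] ->]].
apply: eq_card => x; rewrite !inE subUset sub1set -{1}(setD1K zc).
rewrite !disjoints_subset subUset sub1set inE -!disjoints_subset.
by case: (x \in T); case: (b \subset x); case: (z \in x); case: [disjoint _ & x].
Qed.

Lemma deg_regular_complement : deg_regular t k T -> deg_regular t (#|V| - k) [set ~: x | x in T].
Proof.
move=> [_ Ht]; split=> [_ /imsetP[x xT ->]|]; first by rewrite cardsCs setCK (T_k xT).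
have [//|lam Hlam] := deg_avoid_levels Ht (l := t) (j := 0).
exists lam => b bt; rewrite -(Hlam set0 b) ?cards0 ?disjoints_subset ?sub0set //.
rewrite /deg_avoid -(card_imset _ (@setC_inj V)); apply: eq_card => y; rewrite inE.
apply/andP/imsetP => [[/imsetP[x xT ->] bx]|[x]].
  by exists x => //; rewrite !inE xT sub0set disjoints_subset.
rewrite !inE sub0set disjoints_subset => /andP[xT bx] ->; split=> //.
exact: imset_f.
Qed.
End Complement.

Lemma bin_le_bin_addn n t a : a <= t -> 'C(n, a) <= 'C(n + t, t).
Proof.
move=> at_; rewrite -binomial.Vandermonde (bigD1 (Ordinal (at_ : a < t.+1))) //=.
apply: (@leq_trans ('C(n, a) * 'C(t, t - a))); last exact: leq_addr.
by rewrite leq_pmulr // bin_gt0 leq_subr.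
Qed.

Lemma pow2_le_bin_addn n t : t <= n -> 2 ^ t <= 'C(n + t, t).
Proof.
move=> tn; rewrite -binomial.Vandermonde -[2]/(1 + 1) expnDn; apply: leq_sum => i _.
have it : i <= t by rewrite -ltnS.
rewrite !exp1n !muln1 (bin_sub it) leq_pmull // bin_gt0.
exact: leq_trans it tn.
Qed.

(** Every set of a + b elements is a union of a set of a and one of b. *)
Lemma bin_addr_le n a b : 'C(n, a + b) <= 'C(n, a) * 'C(n, b).
Proof.
have cardE m : 'C(n, m) = #|[set x : {set 'I_n} | x \subset [set: 'I_n] & #|x| == m]|.
  by rewrite cards_draws cardsT card_ord.
rewrite !cardE -cardsX; set X := setX _ _.
apply: leq_trans (leq_imset_card (fun xy => xy.1 :|: xy.2) X).
apply: subset_leq_card; apply/subsetP => x; rewrite inE => /andP[_ /eqP xab].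
have ax : a <= #|x| by rewrite xab leq_addr.
have [y /andP[yx /eqP ya]] := subset_of_card ax.
apply/imsetP; exists (y, x :\: y); last by rewrite /= -{1}(setID x y) (setIidPr yx).
by rewrite !inE !subsetT ya cardsDS // xab ya addKn !eqxx.
Qed.

Lemma bin_le_pow n t m k : k <= m * t -> 'C(n, k) <= 'C(n + t, t) ^ m.
Proof.
elim: m k => [|m IH] k km; first by move: km; rewrite leqn0 => /eqP ->; rewrite bin0.
have [kt|kt] := leqP k t.
  apply: leq_trans (bin_le_bin_addn n kt) _; rewrite expnS leq_pmulr // expn_gt0.
  by rewrite bin_gt0 leq_addl.
rewrite -(subnKC (ltnW kt)) expnS; apply: leq_trans (bin_addr_le _ _ _) _.
by apply: leq_mul; [apply: bin_le_bin_addn | apply: IH; lia].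
Qed.

(** The hypotheses of [design_from_gadget] for gadgets of q^9 blocks, r = q^30
    images at each t-set and deviation s = q^27. *)
Lemma planting_budget q d mu : 2 <= q -> 0 < d -> d <= q -> 0 < mu -> mu <= q ^ 8 ->
  [/\ (q ^ 9) ^ 2 * (d * q ^ 30) * (1 + d * (d * q ^ 30) * (q ^ 9) ^ 2) * d < q ^ 102,
      4 * (d * q ^ 30 * (2 + d * (q ^ 9) ^ 2)) <= (q ^ 27) ^ 2,
      q ^ 27 + mu ^ 2 * d * q ^ 9 <= mu * (q ^ 30 - mu ^ 2 * d),
      mu ^ 2 * d < q ^ 30
    & d * q ^ 30 * q ^ 9 <= q ^ 102].
Proof.
move=> q2 d0 dq mu0 mu8; have q0 : 0 < q by apply: ltnW.
have q4 : 4 <= q ^ 2 by rewrite (leq_exp2r 2 q (isT : 0 < 2)).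
have mono i j : i <= j -> q ^ i <= q ^ j by move=> ij; rewrite leq_exp2l.
have N31 : d * q ^ 30 <= q ^ 31 by rewrite (expnS q 30) leq_mul2r dq orbT.
have g18 : (q ^ 9) ^ 2 = q ^ 18 by rewrite -expnM.
have le19 : d * q ^ 18 <= q ^ 19 by rewrite (expnS q 18) leq_mul2r dq orbT.
have md : mu ^ 2 * d <= q ^ 17.
  by rewrite (expnSr q 16) (expnM q 8 2) leq_mul // leq_exp2r.
split.
- rewrite g18; apply: (@leq_ltn_trans (q ^ 101)); last by rewrite ltn_exp2l.
  have le50 : d * (d * q ^ 30) * q ^ 18 <= q ^ 50.
    by rewrite mulnAC (expnD q 19 31) leq_mul.
  have le51 : 1 + d * (d * q ^ 30) * q ^ 18 <= q ^ 51.
    apply: (@leq_trans (2 * q ^ 50)); last by rewrite (expnS q 50) leq_mul2r q2 orbT.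
    by rewrite mul2n -addnn leq_add // expn_gt0 q0.
  by rewrite (expnSr q 100) (expnD q 49 51) (expnD q 18 31) !leq_mul.
- rewrite g18 -expnM (expnD q 2 52) (expnD q 31 21) !leq_mul //.
  apply: (@leq_trans (2 * q ^ 20)); last by rewrite (expnS q 20) leq_mul2r q2 orbT.
  rewrite mul2n -addnn leq_add //.
    by apply: leq_trans q2 _; rewrite -{1}(expn1 q) mono.
  by apply: leq_trans le19 (mono _ _ _).
- have le26 : mu ^ 2 * d * q ^ 9 <= q ^ 26 by rewrite (expnD q 17 9) leq_mul.
  have l26 := mono 26 27 isT; have l17 := mono 17 27 isT.
  have l28 : 4 * q ^ 27 <= q ^ 30.
    apply: (@leq_trans (q ^ 2 * q ^ 27)); first by rewrite leq_mul2r q4 orbT.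
    by rewrite -expnD mono.
  apply: (@leq_trans (q ^ 30 - mu ^ 2 * d)); last by rewrite leq_pmull.
  move: le26 l26 l17 l28 md; move: (q ^ 26) (q ^ 27) (q ^ 30) (q ^ 17) => x y z u.
  move: (mu ^ 2 * d * q ^ 9) (mu ^ 2 * d) => m1 m2; clear; lia.
- by apply: leq_ltn_trans md _; rewrite ltn_exp2l.
- apply: (@leq_trans (q ^ 31 * q ^ 9)); first by rewrite leq_mul2r N31 orbT.
  by rewrite -expnD mono.
Qed.

(** k >= 42 t leaves room for the code, and C(v, k) >= q^102 for the greedy
    choice of disjoint images. *)
Lemma deg_regular_exists_half v t k : 0 < t -> 42 * t <= k -> 2 * k <= v ->
  'C(v + t, t) ^ 102 <= 'C(v, k) ->
  exists T : {set {set 'I_v}},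
    [/\ deg_regular t k T, T != set0 & #|T| <= 'C(v + t, t) ^ 102].
Proof.
move=> t0 tk kv; have tv : t <= v by lia.
have le1 : k <= v + t by lia.
have le2 : k + t <= v + t by lia.
set q := 'C(v + t, t) => big.
have q2t : 2 ^ t <= q by apply: pow2_le_bin_addn.
have q2 : 2 <= q by apply: leq_trans q2t; rewrite -{1}[2]expn1 leq_exp2l.
have q4 : 4 <= q ^ 2 by rewrite (leq_exp2r 2 q (isT : 0 < 2)).
have q16 : 16 ^ t <= q ^ 4 by rewrite -[16]/(2 ^ 4) -expnM mulnC expnM leq_exp2r.
have kq : 'C(k, t) <= q by apply: leq_bin2l.
have ktq : 'C(k + t, t) <= q by apply: leq_bin2l.
have dq : 'C(v, t) <= q by apply: leq_bin2l; apply: leq_addr.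
have [P [Q [a [mu [a_t PQk degPQ /andP[mu0 mu_le] PQ_le]]]]] := gadget_exists t0 tk kv.
have mu8 : mu <= q ^ 8.
  apply: leq_trans mu_le _; rewrite (_ : q ^ 8 = q ^ 4 * q * (q ^ 2 * q)); last by ring.
  by rewrite !leq_mul.
have g9 : #|P :|: Q| <= q ^ 9.
  apply: leq_trans PQ_le _; rewrite (_ : q ^ 9 = q * (q ^ 4 * q) * (q ^ 2 * q)); last by ring.
  by rewrite !leq_mul.
have cV : #|'I_v| = v := card_ord v.
have d0 : 0 < 'C(v, t) by rewrite bin_gt0.
have [many s_big r_big r_big' size_le] := planting_budget q2 d0 dq mu0 mu8.
have := @design_from_gadget 'I_v t k P Q a mu (q ^ 9) (q ^ 30) (q ^ 27) a_t PQk degPQ mu0 g9.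
rewrite card_ord => /(_ d0 (leq_trans many big) s_big r_big r_big').
move=> [T [lam [Tk Tdeg T0 T_le]]].
exists T; split; [by split=> //; exists lam | by [] | exact: leq_trans T_le size_le].
Qed.

Lemma deg_regular_exists v t k : 0 < t -> t <= k <= v ->
  exists T : {set {set 'I_v}},
    [/\ deg_regular t k T, T != set0 & #|T| <= 'C(v + t, t) ^ 102].
Proof.
move=> t0 /andP[tk kv]; set q := 'C(v + t, t).
have [small|big] := leqP 'C(v, k) (q ^ 102).
  have cT : #|[set x : {set 'I_v} | #|x| == k]| = 'C(v, k).
    rewrite -[in RHS](card_ord v) -cardsT -cards_draws; apply: eq_card => x.
    by rewrite !inE subsetT.
  exists [set x : {set 'I_v} | #|x| == k]; split; last by rewrite cT.
    by apply: deg_regular_all; rewrite card_ord; lia.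
  by rewrite -card_gt0 cT bin_gt0.
have q0 : 0 < q by rewrite bin_gt0 leq_addl.
have large k' : 'C(v, k') = 'C(v, k) -> 42 * t <= k'.
  move=> E; rewrite leqNgt; apply/negP => lt.
  have := @bin_le_pow v t 42 k' (ltnW lt); rewrite E -/q leqNgt => /negP[].
  by apply: leq_ltn_trans big; rewrite leq_pexp2l.
have [k2|k2] := leqP (2 * k) v.
  by apply: deg_regular_exists_half => //; [apply: large | apply: ltnW].
have E : 'C(v, v - k) = 'C(v, k) by rewrite bin_sub.
have [||T [[Tk Tdeg] T0 Tle]] := @deg_regular_exists_half v t (v - k) t0 (large _ E).
- by lia.
- by rewrite E ltnW.
exists [set ~: x | x in T]; split.
- have := @deg_regular_complement _ t _ T Tk _ (conj Tk Tdeg); rewrite card_ord subKn //; apply.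
  by have := large _ E; lia.
- by rewrite -card_gt0 card_imset ?card_gt0 //; apply: setC_inj.
- by rewrite card_imset //; apply: setC_inj.
Qed.

(** * Designs *)

Local Open Scope ring_scope.

(** With y = t / n, the t-th term of the expansion of (1 + y)^n is at most
    (1 + y)^n <= e^(y n) = e^t. *)
Lemma bin_le_expR (R : realType) (n t : nat) : (0 < t)%N ->
  'C(n, t)%:R <= (expR 1 * (n%:R / t%:R)) ^+ t :> R.
Proof.
move=> t0; have [tn|/bin_small ->] := leqP t n; last first.
  by apply: exprn_ge0; rewrite mulr_ge0 ?expR_ge0 // divr_ge0.
have t0' : (0 : R) < t%:R by rewrite ltr0n.
have n0' : (0 : R) < n%:R by rewrite ltr0n (leq_trans t0).
set y : R := t%:R / n%:R; have y0 : 0 < y by apply: divr_gt0.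
have yV : n%:R / t%:R = y^-1 by rewrite invf_div.
rewrite yV exprMn exprVn ler_pdivlMr ?exprn_gt0 //.
apply: (@le_trans _ _ ((1 + y) ^+ n)).
  rewrite exprDn (bigD1 (Ordinal (tn : (t < n.+1)%N))) //= expr1n mul1r -[X in X <= _]addr0.
  rewrite mulr_natl lerD // sumr_ge0 // => i _.
  by rewrite mulrn_wge0 // expr1n mul1r exprn_ge0 // ltW.
apply: (@le_trans _ _ (expR y ^+ n)).
  by rewrite lerXn2r ?nnegrE ?addr_ge0 ?expR_ge0 ?(ltW y0) // expR_ge1Dx.
by rewrite -!expRM_natl /y mulr1 mulrC divfK // gt_eqF.
Qed.

Lemma is_design_of_deg_regular (v t k : nat) (T : {set {set 'I_v}}) :
  deg_regular t k T -> exists lam, is_design t k lam T.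
Proof.
move=> [Tk [lam Tdeg]]; exists lam; split=> // i iI.
rewrite -(Tdeg (i @: [set: 'I_t])); last by rewrite card_imset // cardsT card_ord.
apply: eq_card => s; rewrite !inE; congr (_ && _); apply/forallP/subsetP => [H x|H j].
  by move=> /imsetP[j _ ->].
by apply: H; apply: imset_f.
Qed.

Theorem theorem1p3 (R : realType) :
  exists c : R, 0 < c /\
    forall v t k : nat,
      (1 <= v)%N -> (1 <= t <= v)%N -> (t <= k <= v)%N ->
      exists (lambda : nat) (T : {set {set 'I_v}}),
        [/\ is_design t k lambda T,
            T != set0 &
            (#|T|%:R : R) <= (c * v%:R / t%:R) `^ (c * t%:R)].
Proof.
(* 102 is the exponent of q in the size bound, 2 e bounds the base *)
pose c : R := 102%:R + 2 * expR 1.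
have e0 : (0 : R) < expR 1 := expR_gt0 1.
have e1 : (1 : R) <= expR 1 by apply: le_trans (expR_ge1Dx 1); rewrite lerDl.
have c102 : 102%:R <= c by rewrite lerDl mulr_ge0 // ltW.
have c2e : 2 * expR 1 <= c by rewrite lerDr.
have c0 : 0 < c by apply: lt_le_trans c102; rewrite ltr0n.
exists c; split=> // v t k v0 /andP[t0 tv] tkv.
have [T [/is_design_of_deg_regular[lam Tdes] T0 T_le]] := deg_regular_exists t0 tkv.
exists lam, T; split=> //.
have t0' : (0 : R) < t%:R by rewrite ltr0n.
have vt1 : (1 : R) <= v%:R / t%:R by rewrite ler_pdivlMr // mul1r ler_nat.
pose x : R := 2 * expR 1 * (v%:R / t%:R).
have x1 : 1 <= x.
  by apply: mulr_ege1 => //; apply: mulr_ege1 => //; rewrite ler1n.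
have x0 : 0 <= x by apply: le_trans x1.
have xc : x <= c * v%:R / t%:R by rewrite -mulrA ler_wpM2r // (le_trans _ vt1).
apply: (@le_trans _ _ (x ^+ (102 * t))).
  apply: (@le_trans _ _ (('C(v + t, t) ^ 102)%N%:R)); first by rewrite ler_nat.
  rewrite natrX mulnC exprM lerXn2r ?nnegrE ?exprn_ge0 //.
  apply: le_trans (bin_le_expR R _ t0) _; rewrite lerXn2r ?nnegrE //.
    by rewrite mulr_ge0 ?divr_ge0 // ltW.
  rewrite /x (mulrC 2) -mulrA ler_pM2l // mulrA ler_wpM2r ?invr_ge0 ?ler0n //.
  by rewrite -natrM ler_nat; lia.
rewrite -powR_mulrn //; apply: (@le_trans _ _ (x `^ (c * t%:R))).
  by apply: ler_powR => //; rewrite natrM ler_wpM2r.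
apply: ge0_ler_powR; rewrite ?nnegrE //.
  by rewrite mulr_ge0 // ltW.
exact: le_trans x0 xc.
Qed.
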